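(* Let $q$ be a prime power and let $A\in \mathbb{F}_q^{m\times (2m+1)}$ be a tame, row-balanced matrix of rank $m$. Then the system $Ax^\mathsf{T}=0$ is temperate.
   Context: $A=(a_{ij})$ is row-balanced if each row sums to $0$; $Ax^\mathsf{T}=0$ means $\sum_j a_{ij}x_j=0$ for all $i$, with $x_j\in\mathbb{F}_q^n$. A solution $x$ is generic if the set of $(\mu_1,\ldots,\mu_k)\in\mathbb{F}_q^k$ with $\sum\mu_jx_j=0$ and $\sum\mu_j=0$ equals the row space of $A$. The system is temperate if there is $\delta>0$ such that $|S|=O(q^{(1-\delta)n})$ for every $S\subseteq\mathbb{F}_q^n$ that contains no generic solution (i.e. no generic solution with all $x_j\in S$). A matrix $A\in\mathbb{F}^{m\times k}$ of rank $m$ is tame if, by elementary row operations and column permutations, it cannot be brought into the form $\left(\begin{smallmatrix}A'&0\\ B&C\end{smallmatrix}\right)$ with $A'\in\mathbb{F}^{m'\times k'}$ and $k'\leq 2m'$. *)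

(* Defs.v *)
From HB Require Import structures.
From mathcomp Require Import all_boot all_order all_algebra all_fingroup.
From mathcomp Require Import reals exp.

Set Implicit Arguments.
Unset Strict Implicit.
Unset Printing Implicit Defensive.

Import Order.TTheory GRing.Theory Num.Theory.

Local Open Scope ring_scope.

Definition row_balanced (F : fieldType) (m k : nat) (A : 'M[F]_(m, k)) : Prop :=
  forall i, \sum_j A i j = 0.

Definition is_solution (F : fieldType) (m k n : nat) (A : 'M[F]_(m, k))
    (x : 'I_k -> 'rV[F]_n) : Prop :=
  forall i, \sum_j A i j *: x j = 0.

Definition generic_solution (F : fieldType) (m k n : nat) (A : 'M[F]_(m, k))
    (x : 'I_k -> 'rV[F]_n) : Prop :=
  is_solution A x /\
  forall mu : 'rV[F]_k,
    (\sum_j mu 0 j *: x j = 0 /\ \sum_j mu 0 j = 0) <-> (mu <= A)%MS.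

(* The implied constant C depends only on A: it is uniform in n and S. *)
Definition temperate (R : realType) (F : finFieldType) (m k : nat)
    (A : 'M[F]_(m, k)) : Prop :=
  exists2 delta : R, 0 < delta &
  exists C : R, forall (n : nat) (S : {set 'rV[F]_n}),
    ~ (exists x : 'I_k -> 'rV[F]_n,
         generic_solution A x /\ forall j, x j \in S) ->
    #|S|%:R <= C * #|F|%:R `^ ((1 - delta) * n%:R).

(* A sequence of elementary row operations is left multiplication by an
   invertible P.  The upper left block must have at least one row: with m1 = 0
   and k1 = 0 every matrix has the forbidden shape.  The other blocks may be
   empty (m2 = 0 or k2 = 0). *)
Definition tame (F : fieldType) (m k : nat) (A : 'M[F]_(m, k)) : Prop :=
  ~ exists (m1 m2 k1 k2 : nat) (em : (m1 + m2)%N = m) (ek : (k1 + k2)%N = k)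
      (P : 'M[F]_m) (s : 'S_k)
      (A' : 'M[F]_(m1, k1)) (B : 'M[F]_(m2, k1)) (C : 'M[F]_(m2, k2)),
    [/\ (0 < m1)%N, (k1 <= 2 * m1)%N, P \in unitmx &
        col_perm s (P *m A) = castmx (em, ek) (block_mx A' 0 B C)].

(* Main.v *)
Require Import Defs.
From HB Require Import structures.
From mathcomp Require Import all_boot all_order all_algebra all_fingroup.
From mathcomp Require Import reals exp.
From mathcomp Require Import finfield zify ring lra.

(* Solutions in S are filtered by their rank r.  For r <= m, suppose that S has
   at least q ^ (r n - c b) solutions of rank r, where b is proportional to n;
   one deduces that S also has many solutions of some rank s > r.  By
   pigeonhole, many solutions have the form T C for one fixed k x r matrix T.
   Restricting the vectors to the graphs of random affine maps (one for each
   variable, tied to T), which leaves d coordinates, keeps each such solution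
   with probability q ^ (- h r), h = n - d, and every other solution with
   probability at most q ^ (- h (r + 1)) or q ^ (- h s).  So, if solutions of
   higher rank were rare, solutions T D would dominate in dimension d.

   This is refuted by the slice rank method.  Tameness says, by the matroid
   packing theorem, that the rows of T contain two disjoint bases J1 and J2.
   The indicator of A X = 0 is a polynomial of degree at most m (q - 1) d, so in
   each monomial one of the 2 m + 1 variables has degree less than half of the
   maximum.  Contracting the variables outside of J1 and J2 with functions
   orthogonal to low-degree monomials gives a matrix indexed by the values on
   J1 and on J2, which is of small rank by the polynomial bound, yet diagonal
   with few zeros since T D is determined by its rows in J1, or in J2. *)

Set Implicit Arguments.
Unset Strict Implicit.
Unset Printing Implicit Defensive.

Import Order.TTheory GRing.Theory Num.Theory.

Local Open Scope ring_scope.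

(** * Packing two disjoint bases *)

(* Elements are assigned one by one to [J1] or [J2].  If neither choice for [e]
   kept the inequality, with violating sets [P] and [Q], then by submodularity
   it would already fail for [P :&: Q] or for [e |: (P :|: Q)]. *)
Lemma disjoint_spanning_sets (E : finType) (g : {set E} -> nat) (r : nat) :
  (forall X Y, g (X :|: Y) + g (X :&: Y) <= g X + g Y)%N ->
  (forall X, g X <= r)%N ->
  (forall X, 2 * r <= #|~: X| + 2 * g X)%N ->
  exists J : {set E}, g J = r /\ g (~: J) = r.
Proof.
move=> g_submod g_le g_large.
(* The condition on all [P] is the invariant of the assignment: for [J1 = J2 = set0] it is the third
   hypothesis at [~: P], and once all elements are assigned, [P = set0] gives
   [2 r <= g J1 + g J2]. *)
suff H n : forall J1 J2 : {set E}, [disjoint J1 & J2] -> #|~: (J1 :|: J2)| = n ->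
   (forall P : {set E}, P \subset ~: (J1 :|: J2) ->
      2 * r <= #|P| + g (~: (P :|: J2)) + g (~: (P :|: J1)))%N ->
   exists J : {set E}, g J = r /\ g (~: J) = r.
  apply: (H _ set0 set0 _ erefl); first by rewrite -setI_eq0 setI0.
  by move=> P _; rewrite !setU0 -addnA addnn -mul2n; have := g_large (~: P); rewrite setCK.
elim: n => [|n IHn] J1 J2 dJ cardJ large.
  have /eqP defJ : ~: (J1 :|: J2) == set0 by rewrite -cards_eq0 cardJ.
  have J2E : ~: J1 = J2.
    apply/setP=> x; move/setP/(_ x): defJ; rewrite !inE.
    by move/pred0P/(_ x): dJ => /=; case: (x \in J1); case: (x \in J2).
  have := large set0 (sub0set _); rewrite !set0U cards0 J2E -J2E setCK => le2.
  exists J1; have := g_le J1; have := g_le (~: J1); lia.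
have /card_gt0P[e eP] : (0 < #|~: (J1 :|: J2)|)%N by rewrite cardJ.
have [eJ1 eJ2] : e \notin J1 /\ e \notin J2.
  by move: eP; rewrite !inE negb_or => /andP.
have cardJe (B : {set E}) : B = ~: (J1 :|: J2) :\ e -> #|B| = n.
  by move=> ->; move: cardJ; rewrite (cardsD1 e) eP; case.
have [/forallP ok1|/forallPn[P]] := boolP [forall P : {set E},
   (P \subset ~: ((e |: J1) :|: J2)) ==>
     (2 * r <= #|P| + g (~: (P :|: J2)) + g (~: (P :|: (e |: J1))))%N].
  apply: (IHn (e |: J1) J2); last by move=> P PJ; have := ok1 P; rewrite PJ.
    by rewrite -setI_eq0 setIUl setU_eq0 !setI_eq0 disjoints1 eJ2.
  by apply: cardJe; apply/setP=> x; rewrite !inE; case: (x == e).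
rewrite negb_imply -ltnNge => /andP[PJ Psmall].
have [/forallP ok2|/forallPn[Q]] := boolP [forall P : {set E},
   (P \subset ~: (J1 :|: (e |: J2))) ==>
     (2 * r <= #|P| + g (~: (P :|: (e |: J2))) + g (~: (P :|: J1)))%N].
  apply: (IHn J1 (e |: J2)); last by move=> Q QJ; have := ok2 Q; rewrite QJ.
    by rewrite -setI_eq0 setIUr setU_eq0 !setI_eq0 disjoint_sym disjoints1 eJ1.
  by apply: cardJe; apply/setP=> x; rewrite !inE; case: (x == e); rewrite ?orbT.
rewrite negb_imply -ltnNge => /andP[QJ Qsmall].
have eNP : e \notin P by apply/negP=> /(subsetP PJ); rewrite !inE eqxx.
have eNQ : e \notin Q by apply/negP=> /(subsetP QJ); rewrite !inE eqxx orbT.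
have sub1 := g_submod (~: (P :|: J2)) (~: (Q :|: (e |: J2))).
have sub2 := g_submod (~: (Q :|: J1)) (~: (P :|: (e |: J1))).
have i1 : (P :|: J2) :&: (Q :|: (e |: J2)) = (P :&: Q) :|: J2.
  apply/setP=> x; rewrite !inE; case: (eqVneq x e) => [->|_] /=; last by
    do ![case: (x \in _)].
  by rewrite (negPf eNP) (negPf eNQ) (negPf eJ2).
have i2 : (Q :|: J1) :&: (P :|: (e |: J1)) = (P :&: Q) :|: J1.
  apply/setP=> x; rewrite !inE; case: (eqVneq x e) => [->|_] /=; last by
    do ![case: (x \in _)].
  by rewrite (negPf eNP) (negPf eNQ) (negPf eJ1).
have u1 : (P :|: J2) :|: (Q :|: (e |: J2)) = (e |: (P :|: Q)) :|: J2.
  by apply/setP=> x; rewrite !inE; do ![case: (_ == _) | case: (x \in _)].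
have u2 : (Q :|: J1) :|: (P :|: (e |: J1)) = (e |: (P :|: Q)) :|: J1.
  by apply/setP=> x; rewrite !inE; do ![case: (_ == _) | case: (x \in _)].
rewrite -setCI -setCU i1 u1 in sub1; rewrite -setCI -setCU i2 u2 in sub2.
have PJ12 x : x \in P -> x \in ~: (J1 :|: J2).
  by move/(subsetP PJ); rewrite !inE -orbA negb_or => /andP[].
have QJ12 x : x \in Q -> x \in ~: (J1 :|: J2).
  by move/(subsetP QJ); rewrite !inE orbCA negb_or => /andP[].
have L1 : (2 * r <= #|P :&: Q| + g (~: (P :&: Q :|: J2)) + g (~: (P :&: Q :|: J1)))%N.
  by apply: large; apply/subsetP=> x; rewrite inE => /andP[/PJ12].
have L2 : (2 * r <= #|e |: (P :|: Q)| + g (~: (e |: (P :|: Q) :|: J2))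
                    + g (~: (e |: (P :|: Q) :|: J1)))%N.
  apply: large; apply/subsetP=> x; rewrite in_setU1 in_setU.
  by case/or3P=> [/eqP->|/PJ12|/QJ12].
(* Adding [e] costs only 1 in cardinality, whereas the strict inequalities for [P] and [Q] gain
   2. *)
have := cardsUI P Q; move: L2; rewrite cardsU1 !inE (negPf eNP) (negPf eNQ) /=.
clear -L1 Psmall Qsmall sub1 sub2; lia.
Qed.

Definition row_span (F : fieldType) (k n : nat) (T : 'M[F]_(k, n))
    (Q : {set 'I_k}) : 'M_n :=
  (\sum_(j in Q) <<row j T>>)%MS.

Section RowSpan.
Variables (F : fieldType) (k n : nat) (T : 'M[F]_(k, n)).
Implicit Types Q : {set 'I_k}.

Lemma row_span_subP Q p (B : 'M_(p, n)) :
  reflect (forall j, j \in Q -> (row j T <= B)%MS) (row_span T Q <= B)%MS.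
Proof.
by apply: (iffP sumsmx_subP) => sub j /sub; rewrite genmxE.
Qed.

Lemma row_sub_span Q j : j \in Q -> (row j T <= row_span T Q)%MS.
Proof. by move=> jQ; move/row_span_subP: (submx_refl (row_span T Q)); apply. Qed.

Lemma row_spanS Q1 Q2 : Q1 \subset Q2 -> (row_span T Q1 <= row_span T Q2)%MS.
Proof.
by move=> /subsetP sQ; apply/row_span_subP=> j /sQ; apply: row_sub_span.
Qed.

Lemma row_span_setT : (row_span T setT :=: T)%MS.
Proof.
apply/eqmxP/andP; split; first by apply/row_span_subP=> j _; apply: row_sub.
by apply/row_subP=> j; apply: row_sub_span; rewrite inE.
Qed.

Lemma row_span_submodular Q1 Q2 :
  (\rank (row_span T (Q1 :|: Q2)) + \rank (row_span T (Q1 :&: Q2))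
     <= \rank (row_span T Q1) + \rank (row_span T Q2))%N.
Proof.
rewrite -(mxrank_sum_cap (row_span T Q1)) leq_add //; apply: mxrankS.
  apply/row_span_subP=> j; rewrite in_setU => /orP[] /row_sub_span sj.
    exact: submx_trans sj (addsmxSl _ _).
  exact: submx_trans sj (addsmxSr _ _).
by rewrite sub_capmx !row_spanS ?subsetIl ?subsetIr.
Qed.

(** An element [e] is dropped, and put back only if its row lies outside the span of the remaining
    ones. *)
Lemma row_span_basis Q : exists Q' : {set 'I_k},
  [/\ Q' \subset Q, #|Q'| = \rank (row_span T Q) &
      (row_span T Q' :=: row_span T Q)%MS].
Proof.
move: {2}#|Q| (erefl #|Q|) => c; elim: c Q => [|c IHc] Q cardQ.
  by exists Q; move/cards0_eq: cardQ => ->; rewrite /row_span big_set0 mxrank0 cards0.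
have /card_gt0P[e eQ] : (0 < #|Q|)%N by rewrite cardQ.
have [|Q' [sQ' cardQ' eqQ']] := IHc (Q :\ e).
  by move: cardQ; rewrite (cardsD1 e) eQ; case.
have sQe : Q :\ e \subset Q by apply: subD1set.
have [se|nse] := boolP (row e T <= row_span T (Q :\ e))%MS.
  have eqQ : (row_span T (Q :\ e) :=: row_span T Q)%MS.
    apply/eqmxP; rewrite row_spanS //=; apply/row_span_subP=> j jQ.
    have [->//|je] := eqVneq j e.
    by apply: row_sub_span; rewrite !inE je.
  exists Q'; split; first exact: subset_trans sQ' sQe.
    by rewrite cardQ' eqQ.
  exact: eqmx_trans eqQ' eqQ.
have eNQ' : e \notin Q' by apply/negP=> /(subsetP sQ'); rewrite !inE eqxx.
have eqQ : (row_span T (e |: Q') :=: row_span T Q)%MS.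
  apply/eqmxP; rewrite row_spanS /=; last first.
    by rewrite subUset sub1set eQ (subset_trans sQ').
  apply/row_span_subP=> j jQ; have [->|je] := eqVneq j e.
    by apply: row_sub_span; rewrite !inE eqxx.
  apply: (submx_trans _ (row_spanS (subsetUr [set e] Q'))); rewrite eqQ'.
  by apply: row_sub_span; rewrite !inE je.
exists (e |: Q'); split=> //.
  by rewrite subUset sub1set eQ (subset_trans sQ').
rewrite cardsU1 eNQ' cardQ' -eqQ.
have : row_span T (e |: Q') = (<<row e T>> + row_span T Q')%MS.
  by rewrite /row_span big_setU1.
move=> ->; apply/eqP; rewrite eqn_leq; apply/andP; split; last first.
  rewrite (leq_trans (mxrank_adds_leqif _ _)) // leq_add //; last by rewrite eqQ'.
  by rewrite genmxE rank_leq_row.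
rewrite add1n -eqQ'; apply: rank_ltmx.
rewrite ltmxE addsmxSr /=; apply: contra nse => sub.
rewrite -eqQ'; apply: submx_trans sub; apply: submx_trans (addsmxSl _ _).
by rewrite genmxE.
Qed.

Lemma row_span_full_inj Q d (D1 D2 : 'M[F]_(n, d)) :
  \rank (row_span T Q) = n ->
  (forall j, j \in Q -> row j (T *m D1) = row j (T *m D2)) -> D1 = D2.
Proof.
move=> full eqD; apply/eqP; rewrite -subr_eq0; apply/eqP.
have /row_span_subP sub : forall j, j \in Q -> (row j T <= kermx (D1 - D2))%MS.
  move=> j jQ; apply/sub_kermxP; rewrite mulmxBr -!row_mul eqD ?subrr //.
have fullQ : row_full (row_span T Q) by rewrite /row_full full.
have: (1%:M <= kermx (D1 - D2))%MS by apply: submx_trans sub; apply: submx_full.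
by move/sub_kermxP; rewrite mul1mx.
Qed.

End RowSpan.

Lemma perm_to_back (k : nat) (P : {set 'I_k}) :
  exists s : 'S_k, forall j : 'I_k, (#|~: P| <= j)%N -> s j \in P.
Proof.
pose e := enum (~: P) ++ enum P.
have sz : size e = k.
  by rewrite size_cat -!cardE addnC cardsC card_ord.
have ue : uniq e.
  rewrite cat_uniq !enum_uniq /= andbT; apply/hasPn=> x.
  by rewrite !mem_enum inE negbK.
have inj : injective (fun j : 'I_k => nth j e j).
  move=> i j; rewrite (set_nth_default j) ?sz // => /eqP.
  by rewrite nth_uniq ?sz // => /eqP/val_inj.
exists (perm inj) => j lej; rewrite permE nth_cat -cardE ltnNge lej /=.
rewrite -mem_enum mem_nth // -cardE ltn_subLR //.
by rewrite addnC cardsC card_ord.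
Qed.

(** If the columns in [P] have rank [r < m], row operations make [m - r] rows vanish on them. Moving
    these columns to the back leaves a block with [2 m + 1 - #|P|] columns, which is at most
    [2 (m - r)] as soon as [#|P| > 2 r]. *)
Lemma tame_card_le (F : fieldType) (m : nat) (A : 'M[F]_(m, (2 * m + 1)%N)) :
  tame A -> forall P : {set 'I_(2 * m + 1)},
  (\rank (row_span A^T P) < m -> #|P| <= 2 * \rank (row_span A^T P))%N.
Proof.
move=> tameA P; set r := \rank _ => r_lt; rewrite leqNgt; apply/negP=> P_gt.
apply: tameA; have cP := cardsC P; rewrite card_ord in cP.
have [s sP] := perm_to_back P.
(* The rows of [K] span the vectors orthogonal to the columns in [P]; the first [m - r] rows of the
   invertible matrix [row_ebase K] form a basis of that space. *)
pose K := kermx (row_span A^T P)^T.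
have rK : \rank K = (m - r)%N by rewrite mxrank_ker mxrank_tr.
have zeroK (i : 'I_m) j : (i < m - r)%N -> j \in P -> (row_ebase K *m A) i j = 0.
  move=> lti jP.
  have sub1 : (row i (row_ebase K) <= K)%MS.
    rewrite -rK in lti.
    rewrite -(eq_row_base K) (_ : row i _ = row (Ordinal lti) (row_base K)) ?row_sub //.
    apply/rowP=> l; rewrite /row_base !mxE (bigD1 i) //= big1 => [|c ci].
      by rewrite !mxE eqxx lti mul1r addr0.
    by rewrite !mxE /= (_ : (i == c :> nat) = false) ?mul0r // eq_sym; apply/negbTE.
  have sub2 : (row j A^T <= row_span A^T P)%MS by apply: row_sub_span.
  have [B defB] := submxP sub2; have /sub_kermxP K0 := sub1.
  have: row i (row_ebase K) *m (row j A^T)^T = 0.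
    by rewrite defB trmx_mul mulmxA K0 mul0mx.
  move/matrixP/(_ 0 0); rewrite mxE [RHS]mxE => <-; rewrite mxE.
  by apply: eq_bigr => l _; rewrite !mxE.
have em : ((m - r) + r)%N = m by rewrite subnK // ltnW.
have ek : (#|~: P| + #|P|)%N = (2 * m + 1)%N by rewrite addnC.
pose X := castmx (esym em, esym ek) (col_perm s (row_ebase K *m A)).
exists (m - r)%N, r, #|~: P|, #|P|, em, ek, (row_ebase K), s.
exists (ulsubmx X), (dlsubmx X), (drsubmx X).
split; [by rewrite subn_gt0 | lia | exact: row_ebase_unit | ].
have ur0 : ursubmx X = 0.
  apply/matrixP=> i j; rewrite !mxE castmxE /= !mxE.
  have := zeroK (cast_ord (esym (esym em)) (lshift r i))
    (s (cast_ord (esym (esym ek)) (rshift #|~: P| j))).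
  rewrite mxE => -> //; first by rewrite /= ltn_ord.
  by apply: sP; rewrite /= leq_addr.
by rewrite -ur0 submxK castmxKV.
Qed.

Lemma rank_row_span_rowsub (F : fieldType) (k n : nat) (T : 'M[F]_(k, n))
    (P : {set 'I_k}) :
  \rank (row_span T P) = \rank (rowsub (fun i : 'I_#|P| => enum_val i) T).
Proof.
apply: eqmx_rank; apply/andP; split.
  apply/row_span_subP=> j jP.
  rewrite (_ : row j T = row (enum_rank_in jP j) (rowsub (fun i : 'I_#|P| => enum_val i) T)).
    exact: row_sub.
  by apply/rowP=> l; rewrite !mxE enum_rankK_in.
apply/row_subP=> i; rewrite (_ : row i _ = row (enum_val i) T).
  by apply: row_sub_span; apply: enum_valP.
by apply/rowP=> l; rewrite !mxE.
Qed.

(** A form of matroid duality. The column combinations of [T] that vanish on [Q] form a space of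
    dimension [r - \rank (row_span T Q)]; they are supported on [~: Q] and annihilated by the
    columns of [A] there. *)
Lemma kernel_rank_le (F : fieldType) (m k r : nat) (A : 'M[F]_(m, k))
    (T : 'M[F]_(k, r)) (Q : {set 'I_k}) :
  A *m T = 0 -> \rank T = r ->
  (r + \rank (row_span A^T (~: Q)) <= #|~: Q| + \rank (row_span T Q))%N.
Proof.
move=> AT0 rT; set P := ~: Q.
pose N := (kermx (row_span T Q)^T)^T.
have TN0 j : j \in Q -> row j (T *m N) = 0.
  move=> jQ; rewrite row_mul; have [B ->] := submxP (row_sub_span T jQ).
  by rewrite -mulmxA -[X in B *m X]trmxK trmx_mul trmxK mulmx_ker trmx0 mulmx0.
pose f := fun i : 'I_#|P| => enum_val i.
have AT : colsub f A *m rowsub f (T *m N) = 0.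
  rewrite -[RHS](mul0mx _ N) -AT0 -mulmxA; apply/matrixP=> i j; rewrite !mxE.
  rewrite [RHS](bigID (mem P)) /= [X in _ + X]big1 => [|l lP]; last first.
    rewrite inE negbK in lP; have /rowP/(_ j) := TN0 l lP.
    by rewrite [LHS]mxE [X in _ = X -> _]mxE => ->; rewrite mulr0.
  rewrite addr0 [RHS](big_enum_val (fun l => A i l * (T *m N) l j)) /=.
  by apply: eq_bigr => l _; rewrite [in LHS]mxE [X in _ * X]mxE.
have rN : \rank N = (r - \rank (row_span T Q))%N.
  by rewrite mxrank_tr mxrank_ker mxrank_tr.
have rTN : \rank (T *m N) = \rank N.
  rewrite -mxrank_tr trmx_mul mxrankMfree ?mxrank_tr //.
  by rewrite /row_free mxrank_tr rT.
have le1 : (\rank (T *m N) <= \rank (rowsub f (T *m N)))%N.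
  rewrite -rank_row_span_rowsub; apply: mxrankS; apply/row_subP=> j.
  have [jQ|jP] := boolP (j \in Q); first by rewrite TN0 // sub0mx.
  by apply: row_sub_span; rewrite inE.
have := mulmx0_rank_max AT.
have -> : \rank (colsub f A) = \rank (row_span A^T P).
  by rewrite rank_row_span_rowsub -[in LHS]mxrank_tr trmx_mxsub.
have := rank_leq_col (row_span T Q); lia.
Qed.

(** This is the hypothesis of the packing lemma. With [a] the rank of the columns of [A] in [~: Q],
    [kernel_rank_le] suffices whenever [#|~: Q| <= 2 a]. Tameness gives this if [a < m]; if [a = m]
    it fails only for [Q] empty, where [r <= m] suffices. *)
Lemma tame_kernel_large (F : fieldType) (m r : nat) (A : 'M[F]_(m, (2 * m + 1)%N))
    (T : 'M[F]_((2 * m + 1)%N, r)) (Q : {set 'I_(2 * m + 1)}) :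
  tame A -> A *m T = 0 -> \rank T = r -> (r <= m)%N ->
  (2 * r <= #|~: Q| + 2 * \rank (row_span T Q))%N.
Proof.
move=> tameA AT0 rT r_le.
have := kernel_rank_le Q AT0 rT.
have := rank_leq_row (row_span A^T (~: Q)).
have := @tame_card_le _ _ _ tameA (~: Q).
have : (#|~: Q| <= 2 * m + 1)%N by rewrite -[X in (_ <= X)%N]card_ord max_card.
set a := \rank _; set b := #|_|; set c := \rank _.
by move=> le_b le_ab; case: (ltnP a m) => [/le_ab|]; lia.
Qed.

(** * Counting and polynomial expansions over finite fields *)

Lemma card_mulmx_fiber (F : finFieldType) (p n h : nat) (B : 'M[F]_(p, n))
    (W : 'M[F]_(p, h)) :
  (#|[set Z : 'M[F]_(n, h) | B *m Z == W]| <= #|F| ^ (h * (n - \rank B)))%N.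
Proof.
have [->|[Z0]] := set_0Vmem [set Z : 'M[F]_(n, h) | B *m Z == W].
  by rewrite cards0.
rewrite inE => /eqP BZ0; set K := kermx B^T.
have rK : \rank K = (n - \rank B)%N by rewrite mxrank_ker mxrank_tr.
rewrite -rK -card_mx -cardsT.
apply: leq_trans (leq_imset_card (fun Y => Z0 + (Y *m row_base K)^T) _).
apply/subset_leq_card/subsetP=> Z; rewrite inE => /eqP BZ.
have: ((Z - Z0)^T <= row_base K)%MS.
  rewrite eq_row_base; apply/sub_kermxP.
  by rewrite -trmx_mul mulmxBr BZ BZ0 subrr trmx0.
case/submxP=> Y defY; apply/imsetP; exists Y; rewrite ?inE //.
by rewrite -defY trmxK addrC subrK.
Qed.

(** Take [h] of maximal support. If it had more than [#|I|] zeros in [Y], linear algebra would give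
    a nonzero function supported on these zeros and orthogonal to every [f i]; adding it to [h]
    would enlarge the support. *)
Lemma large_support_orthogonal (F : finFieldType) (T I : finType) (Y : {set T})
    (f : I -> T -> F) :
  exists h : {ffun T -> F},
    [/\ forall y, y \notin Y -> h y = 0,
        forall i, \sum_y h y * f i y = 0 &
        (#|[set y in Y | h y == 0%R]| <= #|I|)%N].
Proof.
pose P (h : {ffun T -> F}) := [forall y, (y \notin Y) ==> (h y == 0)]
  && [forall i, \sum_y h y * f i y == 0].
have P0 : P [ffun=> 0].
  apply/andP; split; first by apply/forallP=> y; rewrite ffunE eqxx implybT.
  by apply/forallP=> i; rewrite big1 // => y _; rewrite ffunE mul0r.
case: (arg_maxnP (fun h : {ffun T -> F} => #|[set y | h y != 0]|) P0).
move=> h /andP[/forallP hY /forallP hf] hmax.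
have hY0 y : y \notin Y -> h y = 0 :> F by move=> yY; have := hY y; rewrite yY => /eqP.
exists h; split=> //; first by move=> i; apply/eqP.
set Z := [set y in Y | _]; rewrite leqNgt; apply/negP=> Z_gt.
pose M := \matrix_(a < #|Z|, i < #|I|) f (enum_val i) (enum_val a).
have: kermx M != 0.
  rewrite kermx_eq0 /row_free; apply/eqP=> rM.
  by have := rank_leq_col M; rewrite rM leqNgt Z_gt.
case/rowV0Pn=> v /sub_kermxP vM v0.
pose h' : {ffun T -> F} := [ffun y => \sum_a v 0 a * (enum_val a == y)%:R].
have h'Z y : y \notin Z -> h' y = 0.
  move=> yZ; rewrite ffunE big1 // => a _; case: eqP => [ay|]; last by rewrite mulr0.
  by move: yZ; rewrite -ay enum_valP.
have h'E a : h' (enum_val a) = v 0 a.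
  rewrite ffunE (bigD1 a) //= eqxx mulr1 big1 ?addr0 // => b ba.
  by rewrite (inj_eq enum_val_inj) (negPf ba) mulr0.
have h'f i : \sum_y h' y * f i y = 0.
  have /matrixP/(_ 0 (enum_rank i)) := vM; rewrite mxE [RHS]mxE => vMi.
  rewrite -[RHS]vMi.
  under eq_bigr do rewrite ffunE mulr_suml.
  rewrite exchange_big; apply: eq_bigr => a _ /=.
  rewrite mxE enum_rankK (bigD1 (enum_val a)) //= eqxx mulr1 big1 ?addr0 // => y ya.
  by rewrite eq_sym (negPf ya) mulr0 mul0r.
have Ph : P [ffun y => h y + h' y].
  apply/andP; split; apply/forallP=> y.
    apply/implyP=> yY; rewrite ffunE hY0 // h'Z ?addr0 //.
    by rewrite inE (negPf yY).
  under eq_bigr do rewrite ffunE mulrDl.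
  by rewrite big_split /= h'f addr0.
have [a va] : exists a, v 0 a != 0.
  apply/existsP; apply: contraR v0 => /existsPn va; apply/eqP/rowP=> a.
  by rewrite mxE; apply/eqP; have := va a; rewrite negbK.
have := hmax _ Ph; rewrite /= leqNgt => /negP; apply; apply: proper_card.
apply/properP; split.
  apply/subsetP=> y; rewrite !inE ffunE => hy.
  by rewrite h'Z ?addr0 // inE (negPf hy) andbF.
have := enum_valP a; rewrite inE => /andP[_ /eqP ha].
have hh'a : [ffun y => h y + h' y] (enum_val a) = v 0 a.
  by rewrite ffunE ha add0r; apply: h'E.
by exists (enum_val a); rewrite inE ?hh'a // ha eqxx.
Qed.

Section Expansion.
Variable F : finFieldType.
Local Notation p := #|F|.-1.

Lemma card_finField_pred : p.+1 = #|F|.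
Proof. by rewrite prednK // ltnW // finNzRing_gt1. Qed.

Lemma card_finField_pred_gt0 : (0 < p)%N.
Proof. by have := finNzRing_gt1 F; rewrite -card_finField_pred ltnS. Qed.

Lemma expf_pred_card (x : F) : x ^+ p = (x != 0)%:R.
Proof.
have [->|x0] := eqVneq x 0.
  by rewrite expr0n; case: p card_finField_pred_gt0.
by apply: (mulfI x0); rewrite mulr1 -exprS card_finField_pred expf_card.
Qed.

(** Reduced polynomial functions: the type ['I_p.+1] keeps each exponent at most [q - 1], and [D]
    bounds the total degree. Exponents may repeat in [s], so that sums are concatenations. *)
Definition span_deg_le (k D : nat) (f : ('I_k -> F) -> F) : Prop :=
  exists2 s : seq (F * {ffun 'I_k -> 'I_p.+1}),
    all (fun t : F * {ffun 'I_k -> 'I_p.+1} => (\sum_j t.2 j <= D)%N) s &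
    forall v, f v = \sum_(t <- s) t.1 * \prod_j v j ^+ t.2 j.

Lemma span_deg_le_const k a : span_deg_le 0 (fun _ : 'I_k -> F => a).
Proof.
exists [:: (a, [ffun=> ord0])] => [|v]; last first.
  by rewrite big_seq1 big1 ?mulr1 // => j _; rewrite ffunE expr0.
by rewrite /= andbT leqn0 sum_nat_eq0; apply/forallP=> j; rewrite ffunE.
Qed.

Lemma span_deg_le_widen k D1 D2 (f : ('I_k -> F) -> F) :
  (D1 <= D2)%N -> span_deg_le D1 f -> span_deg_le D2 f.
Proof.
move=> leD [s sD sf]; exists s => //.
by apply: sub_all sD => t /leq_trans; apply.
Qed.

Lemma span_deg_le_add k D (f g : ('I_k -> F) -> F) :
  span_deg_le D f -> span_deg_le D g -> span_deg_le D (fun v => f v + g v).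
Proof.
move=> [s sD sf] [t tD tg]; exists (s ++ t) => [|v]; first by rewrite all_cat sD.
by rewrite big_cat /= sf tg.
Qed.

Lemma span_deg_le_scale k D a (f : ('I_k -> F) -> F) :
  span_deg_le D f -> span_deg_le D (fun v => a * f v).
Proof.
move=> [s sD sf]; exists [seq (a * t.1, t.2) | t <- s] => [|v]; first by rewrite all_map.
by rewrite big_map sf mulr_sumr; apply: eq_bigr => t _; rewrite mulrA.
Qed.

(* Exponents wrap around from q to 1, because x ^ q = x. *)
Lemma span_deg_le_mulX k D i (f : ('I_k -> F) -> F) :
  span_deg_le D f -> span_deg_le D.+1 (fun v => v i * f v).
Proof.
move=> [s sD sf].
pose incr (e : 'I_p.+1) : 'I_p.+1 := if (e < p)%N then inord e.+1 else inord 1.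
have incr_le e : (incr e <= e.+1)%N.
  rewrite /incr; case: ifP => lt; rewrite inordK ?ltnS //.
  exact: card_finField_pred_gt0.
have incrE e (x : F) : x ^+ incr e = x * x ^+ e.
  rewrite -exprS /incr; case: ltnP => le; rewrite inordK ?ltnS //.
    have -> : (e : nat) = p by apply/eqP; rewrite eqn_leq le -ltnS ltn_ord.
    by rewrite card_finField_pred expf_card.
  exact: card_finField_pred_gt0.
pose up (e : {ffun 'I_k -> 'I_p.+1}) := [ffun j => if j == i then incr (e j) else e j].
exists [seq (t.1, up t.2) | t <- s] => [|v].
  rewrite all_map; apply: sub_all sD => t /= tD; apply: leq_trans (_ : _ <= (\sum_j t.2 j).+1)%N _ => //.
  rewrite (bigD1 i) //= [X in (_ <= X.+1)%N](bigD1 i) //= -addSn leq_add //.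
    by rewrite ffunE eqxx incr_le.
  by apply: leq_sum => j /negPf ji; rewrite ffunE ji.
rewrite big_map sf mulr_sumr; apply: eq_bigr => t _; rewrite mulrCA; congr (_ * _).
rewrite /= (bigD1 i) //= [in RHS](bigD1 i) //= ffunE eqxx incrE mulrA; congr (_ * _).
by apply: eq_bigr => j /negPf ji; rewrite ffunE ji.
Qed.

Lemma span_deg_le_mul_linear k D (a : 'I_k -> F) (f : ('I_k -> F) -> F) :
  span_deg_le D f -> span_deg_le D.+1 (fun v => (\sum_j a j * v j) * f v).
Proof.
move=> fD.
suff H (r : seq 'I_k) : span_deg_le D.+1 (fun v => (\sum_(j <- r) a j * v j) * f v).
  exact: H.
elim: r => [|j r IHr].
  have [s sD sf] := span_deg_le_widen (leq0n D.+1) (span_deg_le_const k 0).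
  by exists s => // v; rewrite big_nil mul0r; apply: sf.
have [s sD sf] := span_deg_le_add (span_deg_le_scale (a j) (span_deg_le_mulX j fD)) IHr.
by exists s => // v; rewrite big_cons mulrDl -mulrA sf.
Qed.

Lemma span_deg_le_mul_linearX k D l (a : 'I_k -> F) (f : ('I_k -> F) -> F) :
  span_deg_le D f -> span_deg_le (D + l) (fun v => (\sum_j a j * v j) ^+ l * f v).
Proof.
move=> fD; elim: l => [|l [s sD sf]].
  by case: fD => s sD sf; exists s; rewrite ?addn0 // => v; rewrite expr0 mul1r.
have [t tD tf] := span_deg_le_mul_linear a (ex_intro2 _ _ s sD sf).
by exists t; rewrite ?addnS // => v; rewrite exprS -mulrA tf.
Qed.

(** Each row contributes the factor [1 - l ^ (q - 1)], where [l] is its linear form; this factor is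
    the indicator of [l = 0]. *)
Lemma span_deg_le_kernel m k (A : 'M[F]_(m, k)) :
  span_deg_le (m * p) (fun v => (A *m (\col_j v j) == 0)%:R).
Proof.
have H (r : seq 'I_m) : span_deg_le (size r * p)
    (fun v => \prod_(i <- r) (1 - (\sum_j A i j * v j) ^+ p)).
  elim: r => [|i r IHr].
    have [s sD sf] := span_deg_le_const k 1.
    by exists s => // v; rewrite big_nil; apply: sf.
  have [|s sD sf] := span_deg_le_add (span_deg_le_widen _ IHr)
    (span_deg_le_scale (-1) (span_deg_le_mul_linearX p (A i) IHr)).
    exact: leq_addr.
  exists s => [|v]; first by rewrite /= mulSn addnC.
  by rewrite big_cons mulrBl mul1r -sf mulN1r.
have [s sD sf] := H (enum 'I_m); exists s => [|v].
  by move: sD; rewrite size_enum_ord.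
have AvE i : (A *m (\col_j v j)) i 0 = \sum_j A i j * v j.
  by rewrite mxE; apply: eq_bigr => j _; rewrite mxE.
rewrite -sf big_enum /=; have [/eqP Av0|Av] := boolP (_ == _).
  rewrite big1 // => i _; rewrite expf_pred_card.
  by rewrite -AvE Av0 mxE eqxx subr0.
have [i Avi] : exists i, (A *m (\col_j v j)) i 0 != 0.
  apply/existsP; apply: contraR Av => /existsPn Av; apply/eqP/colP=> i.
  by rewrite [RHS]mxE; apply/eqP; have := Av i; rewrite negbK.
by rewrite (bigD1 i) //= expf_pred_card -AvE Avi subrr mul0r.
Qed.

(** The condition [A X = 0] splits over the [d] columns of [X]. Expanding the product of the column
    indicators means choosing one term per column, hence the index type of functions on ['I_d]. *)
Lemma kernel_indicator_expansion m k d (A : 'M[F]_(m, k)) :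
  exists (I : finType) (c : I -> F) (e : I -> 'I_k -> {ffun 'I_d -> 'I_p.+1}),
    (forall i, \sum_j \sum_l e i j l <= d * (m * p))%N /\
    forall X : 'M[F]_(k, d),
      (A *m X == 0)%:R = \sum_i c i * \prod_j \prod_l X j l ^+ e i j l.
Proof.
have [s sD sf] := span_deg_le_kernel A.
pose t (i : 'I_(size s)) := tnth (in_tuple s) i.
exists {ffun 'I_d -> 'I_(size s)}.
exists (fun i : {ffun 'I_d -> 'I_(size s)} => \prod_l (t (i l)).1).
exists (fun (i : {ffun 'I_d -> 'I_(size s)}) j => [ffun l => (t (i l)).2 j]); split=> [i|X].
  rewrite exchange_big /= -[X in (_ <= X * _)%N]card_ord -sum_nat_const.
  apply: leq_sum => l _; under eq_bigr do rewrite ffunE.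
  by apply: (allP sD); apply: mem_tnth.
transitivity (\prod_(l < d) (A *m (\col_j X j l) == 0)%:R : F).
  have colE i l : (A *m (\col_j X j l)) i 0 = (A *m X) i l.
    by rewrite !mxE; apply: eq_bigr => j _; rewrite mxE.
  have [/eqP AX0|AX] := boolP (A *m X == 0).
    rewrite big1 // => l _; rewrite (_ : _ *m _ = 0) ?eqxx //; apply/colP=> i.
    by rewrite colE AX0 !mxE.
  have [/existsP[l Xl]|/existsPn Xl] :=
    boolP [exists l, A *m (\col_j X j l) != 0].
    by rewrite (bigD1 l) //= (negPf Xl) mul0r.
  case/eqP: AX; apply/matrixP=> i l; rewrite -colE [RHS]mxE.
  by have := Xl l; rewrite negbK => /eqP->; rewrite mxE.
under eq_bigr do rewrite sf big_tnth.
rewrite bigA_distr_bigA /=; apply: eq_bigr => i _.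
rewrite big_split /= exchange_big /=; congr (_ * _).
by apply: eq_bigr => j _; apply: eq_bigr => l _; rewrite ffunE.
Qed.

End Expansion.

(** * The slice rank bound *)

Lemma card_bigcup_le (I T : finType) (P : pred I) (S : I -> {set T}) :
  (#|\bigcup_(i | P i) S i| <= \sum_(i | P i) #|S i|)%N.
Proof.
elim/big_rec2: _ => [|i n U _ le]; first by rewrite cards0.
by rewrite (leq_trans (leq_card_setU _ _)) // leq_add2l.
Qed.

(* The hypothesis describes an invertible diagonal matrix as a sum of two
   products with inner dimensions [#|K1|] and [#|K2|]. *)
Lemma card_le_diagonal_rank (F : fieldType) (T K : finType) (S : {set T})
    (K1 K2 : {set K}) (u1 v1 u2 v2 : K -> T -> F) :
  (forall x y, x \in S -> y \in S ->
     (\sum_(i in K1) u1 i x * v1 i y + \sum_(i in K2) u2 i x * v2 i y == 0)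
       = (x != y)) ->
  (#|S| <= #|K1| + #|K2|)%N.
Proof.
move=> diag.
pose L (K0 : {set K}) (u : K -> T -> F) :=
  \matrix_(a < #|S|, i < #|K0|) u (enum_val i) (enum_val a).
pose R (K0 : {set K}) (v : K -> T -> F) :=
  \matrix_(i < #|K0|, a < #|S|) v (enum_val i) (enum_val a).
pose M := L K1 u1 *m R K1 v1 + L K2 u2 *m R K2 v2.
have ME a b : M a b = \sum_(i in K1) u1 i (enum_val a) * v1 i (enum_val b)
    + \sum_(i in K2) u2 i (enum_val a) * v2 i (enum_val b).
  rewrite mxE; congr (_ + _); rewrite mxE [RHS]big_enum_val /=;
  by apply: eq_bigr => i _; rewrite !mxE.
have defM : M = diag_mx (\row_a M a a).
  apply/matrixP=> a b; rewrite [RHS]mxE [(\row__ _) _ _]mxE.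
  have [->|ab] := eqVneq a b; first by rewrite mulr1n.
  rewrite mulr0n ME; apply/eqP.
  by rewrite diag ?enum_valP // (inj_eq enum_val_inj).
have unitM : M \in unitmx.
  rewrite defM unitmxE det_diag unitfE; apply/prodf_neq0=> a _.
  by rewrite mxE ME diag ?enum_valP // eqxx.
rewrite -(mxrank_unit unitM) (leq_trans (mxrank_add _ _)) // leq_add //.
  by rewrite (leq_trans (mxrankM_maxl _ _)) // rank_leq_col.
by rewrite (leq_trans (mxrankM_maxl _ _)) // rank_leq_col.
Qed.

Lemma card_family_prod (aT rT : finType) (f : aT -> {set rT}) :
  #|[set g : {ffun aT -> rT} | [forall x, g x \in f x]]| = (\prod_x #|f x|)%N.
Proof.
rewrite -sum1_card (eq_bigr (fun x => \sum_(y in f x) 1)%N); last first.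
  by move=> x _; rewrite sum1_card.
rewrite bigA_distr_big_dep /=; apply: eq_big => [g|g _].
  by rewrite !inE; apply/forallP/familyP.
by rewrite big1.
Qed.

(** Exponents of one vector variable whose degree is at most the average [d m (q - 1) / k]; the
    division is cleared. Every monomial in the expansion of the indicator has such a variable. *)
Definition low_exponents (F : finFieldType) (m k d : nat) :
    {set {ffun 'I_d -> 'I_#|F|.-1.+1}} :=
  [set e : {ffun 'I_d -> 'I_#|F|.-1.+1} | (k * \sum_l e l <= d * (m * #|F|.-1))%N].

Section SliceBound.
Variables (F : finFieldType) (m k r d : nat).
Variables (A : 'M[F]_(m, k)) (T : 'M[F]_(k, r)) (Y : 'I_k -> {set 'rV[F]_d}).
Local Notation expo := {ffun 'I_d -> 'I_#|F|.-1.+1}.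
Local Notation B := (low_exponents F m k d).

Definition monomial (e : expo) (y : 'rV[F]_d) : F := \prod_l y 0 l ^+ e l.

Definition lies_in (X : 'M[F]_(k, d)) : bool := [forall j, row j X \in Y j].

(** The last condition says that [X] is not of the form [T *m D]. *)
Definition extra_solutions : {set 'M[F]_(k, d)} :=
  [set X | [&& A *m X == 0, lies_in X & ~~ (X^T <= T^T)%MS]].

(* Monomials in the variables indexed by [J'] of low degree in at least one of
   them; the exponents of the other variables are the junk value [0]. *)
Definition low_keys (J' : {set 'I_k}) : {set {ffun 'I_k -> expo}} :=
  [set g : {ffun 'I_k -> expo} | [forall j, (j \notin J') ==> (g j == [ffun=> ord0])] &&
           [exists j, (j \in J') && (g j \in B)]].

(** A union bound over the variable of low degree: each of the other variables in [J'] has [q ^ d]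
    possible exponents. *)
Lemma card_low_keys (J' : {set 'I_k}) :
  (#|low_keys J'| <= #|J'| * (#|B| * #|F| ^ (d * (#|J'| - 1))))%N.
Proof.
pose f (j0 j : 'I_k) : {set expo} :=
  if j == j0 then B else if j \in J' then setT else [set [ffun=> ord0]].
apply: (@leq_trans #|\bigcup_(j0 in J')
    [set g : {ffun 'I_k -> expo} | [forall j, g j \in f j0 j]]|).
  apply/subset_leq_card/subsetP=> g; rewrite inE.
  case/andP=> /forallP g0 /existsP[j0 /andP[j0J gB]].
  apply/bigcupP; exists j0 => //; rewrite inE; apply/forallP=> j; rewrite /f.
  have [->//|_] := eqVneq; have := g0 j; case: (j \in J') => //=.
  by rewrite inE.
rewrite (leq_trans (card_bigcup_le _ _)) // -sum_nat_const; apply: leq_sum => j0 j0J.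
rewrite card_family_prod (bigD1 j0) //= /f eqxx leq_mul2l; apply/orP; right.
rewrite (bigID (mem J')) /= [X in (_ * X)%N]big1 => [|j /andP[/negPf-> /negPf->]]; last first.
  by rewrite cards1.
rewrite muln1 (eq_bigr (fun=> #|F| ^ d)%N) => [|j /andP[/negPf-> ->]]; last first.
  by rewrite cardsT card_ffun !card_ord card_finField_pred.
rewrite prod_nat_const -expnM leq_exp2l ?finNzRing_gt1 // leq_mul2l.
rewrite (_ : #|_| = #|J'| - 1)%N ?leqnn ?orbT //.
rewrite (cardsD1 j0 J') j0J add1n subn1 /=.
by apply: eq_card => j; rewrite !inE.
Qed.

(** A matrix [C] is discarded if [T *m C] agrees on [J1] with an extra solution, or if some [h j]
    vanishes at its row [j] outside of [J1] and [J2]. On the rest the contracted matrix is diagonal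
    without zeros. With [N = #|B| * q ^ (d * (r - 1))], its rank is at most [2 r N] and the second
    loss at most [(k - 2 r) N], which add up to [k N]. *)
Lemma card_param_le (k_gt0 : (0 < k)%N) (J : {set 'I_k}) :
  A *m T = 0 -> (forall j, row j T != 0) ->
  \rank (row_span T J) = r -> \rank (row_span T (~: J)) = r ->
  (#|[set D : 'M[F]_(r, d) | lies_in (T *m D)]|
     <= k * (#|B| * #|F| ^ (d * (r - 1))) + #|extra_solutions|)%N.
Proof.
move=> AT0 Tj fullJ fullJc.
have [J1 [sJ1 cJ1 eqJ1]] := row_span_basis T J.
have [J2 [sJ2 cJ2 eqJ2]] := row_span_basis T (~: J).
rewrite fullJ in cJ1; rewrite fullJc in cJ2.
have r1 : \rank (row_span T J1) = r by rewrite eqJ1.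
have r2 : \rank (row_span T J2) = r by rewrite eqJ2.
have J12 j : j \in J2 -> j \notin J1.
  by move=> /(subsetP sJ2) jJ; apply/negP=> /(subsetP sJ1) jJ'; rewrite inE jJ' in jJ.
have [h hP] := fin_all_exists (fun j => large_support_orthogonal (Y j)
  (fun (e : {e | e \in B}) y => monomial (val e) y)).
have hY j y : h j y != 0 -> y \in Y j.
  by have [hj _ _] := hP j; apply: contraNT => /hj->.
have hB j e : e \in B -> \sum_y h j y * monomial e y = 0.
  by move=> eB; have [_ hj _] := hP j; apply: (hj (Sub e eB)).
have hZ j : (#|[set y in Y j | h j y == 0%R]| <= #|B|)%N.
  by have [_ _] := hP j; rewrite card_sig.
have [I [c [e [eD eE]]]] := kernel_indicator_expansion d A.
have low i : exists j, e i j \in B.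
  apply/existsP; apply: contraLR (eD i) => /existsPn nlow; rewrite -ltnNge.
  rewrite -(ltn_pmul2l k_gt0) big_distrr /=.
  rewrite (@leq_trans (k * (d * (m * #|F|.-1)).+1)%N) ?ltn_pmul2l //.
  rewrite -[X in (X * _ <= _)%N]card_ord -sum_nat_const; apply: leq_sum => j _.
  by have := nlow j; rewrite inE -ltnNge.
pose mx (g : {ffun 'I_k -> 'rV[F]_d}) := \matrix_(j, l) g j 0 l.
have row_mx g j : row j (mx g) = g j by apply/rowP=> l; rewrite !mxE.
(* [M C C'] contracts the indicator of [A X = 0] with point masses at the rows of [T *m C] on [J1]
   and of [T *m C'] on [J2], and with [h j] elsewhere. *)
pose W C C' j y : F := if j \in J1 then (y == row j (T *m C))%:R
  else if j \in J2 then (y == row j (T *m C'))%:R else h j y.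
pose M C C' := \sum_g (A *m mx g == 0)%:R * \prod_j W C C' j (g j).
pose key (J' : {set 'I_k}) i : {ffun 'I_k -> expo} :=
  [ffun j => if j \in J' then e i j else [ffun=> ord0]].
pose u (J' : {set 'I_k}) (g : {ffun 'I_k -> expo}) C :=
  \prod_(j in J') monomial (g j) (row j (T *m C)).
pose w i := \prod_(j | (j \notin J1) && (j \notin J2))
  \sum_y h j y * monomial (e i j) y.
have uE (J' : {set 'I_k}) i C : u J' (key J' i) C =
    \prod_(j in J') monomial (e i j) (row j (T *m C)).
  by apply: eq_bigr => j jJ; rewrite ffunE jJ.
have sum_delta (a : 'rV[F]_d) f : \sum_y (y == a)%:R * f y = f a :> F.
  by rewrite (bigD1 a) //= eqxx mul1r big1 ?addr0 // => y /negPf->; rewrite mul0r.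
have ME C C' : M C C' = \sum_i c i * (u J1 (key J1 i) C * (u J2 (key J2 i) C' * w i)).
  transitivity (\sum_i c i * \prod_j \sum_y W C C' j y * monomial (e i j) y).
    rewrite /M; under eq_bigr do rewrite eE mulr_suml.
    rewrite exchange_big /=; apply: eq_bigr => i _.
    rewrite bigA_distr_bigA /= mulr_sumr; apply: eq_bigr => g _.
    rewrite -mulrA -big_split /=; congr (_ * _); apply: eq_bigr => j _.
    rewrite mulrC; congr (_ * _); apply: eq_bigr => l _.
    by rewrite -[in RHS](row_mx g j) [in RHS]mxE.
  apply: eq_bigr => i _; congr (_ * _); rewrite (bigID (mem J1)) /=; congr (_ * _).
    by rewrite uE; apply: eq_bigr => j jJ; rewrite /W jJ sum_delta.
  rewrite (bigID (mem J2)) /=; congr (_ * _); last first.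
    by apply: eq_bigr => j /andP[/negPf jJ1 /negPf jJ2]; rewrite /W jJ1 jJ2.
  rewrite uE; apply: eq_big => j; first by case: (boolP (j \in J2)) => [/J12->|]; rewrite ?andbF.
  by case/andP=> /negPf jJ1 jJ2; rewrite /W jJ1 jJ2 sum_delta.
pose K1 := low_keys J1; pose K2 := low_keys J2.
have keyK (J' : {set 'I_k}) i j : j \in J' -> e i j \in B -> key J' i \in low_keys J'.
  move=> jJ ej; rewrite inE; apply/andP; split.
    by apply/forallP=> j'; apply/implyP=> /negPf j'J; rewrite ffunE j'J.
  by apply/existsP; exists j; rewrite jJ ffunE jJ.
(* A monomial goes to the first sum if it has low degree in a variable of [J1], otherwise to the
   second if it has low degree in one of [J2]. *)
pose v1 g C' := \sum_(i | key J1 i == g) c i * (u J2 (key J2 i) C' * w i).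
pose v2 g C := \sum_(i | (key J1 i \notin K1) && (key J2 i == g))
  c i * (u J1 (key J1 i) C * w i).
have Msplit C C' : M C C' = \sum_(g in K1) u J1 g C * v1 g C'
    + \sum_(g in K2) v2 g C * u J2 g C'.
  rewrite ME (bigID (fun i => key J1 i \in K1)) /=; congr (_ + _).
    rewrite (partition_big (key J1) (mem K1)) //=; apply: eq_bigr => g gK.
    rewrite mulr_sumr; apply: eq_big => [i|i /andP[_ /eqP->]]; last by rewrite mulrCA.
    by case: eqP => [->|]; rewrite ?gK ?andbF.
  rewrite (bigID (fun i => key J2 i \in K2)) /= [X in _ + X]big1 ?addr0 => [|i /andP[nK1 nK2]].
    rewrite (partition_big (key J2) (mem K2)) => [|i /andP[]//] /=.
    apply: eq_bigr => g gK; rewrite mulr_suml.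
    apply: eq_big => [i|i /andP[_ /eqP->]]; last by rewrite -!mulrA [w i * _]mulrC.
    by case: (eqVneq (key J2 i) g) => [->|]; rewrite ?gK ?andbF ?andbT.
  (* The variable of low degree now lies outside of [J1] and [J2], so its [h j] annihilates the
     monomial. *)
  have [j ej] := low i; rewrite /w (bigD1 j) /= ?hB ?mul0r ?mulr0 //.
  by apply/andP; split; apply/negP=> /keyK/(_ ej); apply/negP.
pose Phi := [set D : 'M[F]_(r, d) | lies_in (T *m D)].
pose Bad := [set C in Phi | [exists X in extra_solutions,
  [forall j in J1, row j X == row j (T *m C)]]].
pose Zero j := [set C : 'M[F]_(r, d) | row j T *m C \in [set y in Y j | h j y == 0%R]].
pose Rest := ~: (J1 :|: J2).
pose S := Phi :\: (Bad :|: \bigcup_(j in Rest) Zero j).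
have leS : (#|S| <= #|K1| + #|K2|)%N.
  apply: (@card_le_diagonal_rank _ _ _ S K1 K2 (u J1) v1 v2 (u J2)) => C C'.
  rewrite !inE !negb_or => /andP[/andP[CBad CZero] CPhi] /andP[_ C'Phi].
  rewrite -Msplit.
  (* A nonzero term is a solution within [Y]. Since [C] is not in [Bad], it has the form [T *m D],
     and [D] is equal to [C] by its rows in [J1] and to [C'] by its rows in [J2]. *)
  have mxT g : (A *m mx g == 0)%:R * \prod_j W C C' j (g j) != 0 ->
      C = C' /\ g = [ffun j => row j (T *m C)].
    rewrite mulf_eq0 negb_or => /andP[]; case: (A *m mx g =P 0) => [Ag _|_]; last by rewrite eqxx.
    move=> /prodf_neq0 Wg.
    have gJ1 j : j \in J1 -> g j = row j (T *m C).
      by move=> jJ; have := Wg j isT; rewrite /W jJ; case: (g j =P _); rewrite ?eqxx.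
    have gJ2 j : j \in J2 -> g j = row j (T *m C').
      move=> jJ; have := Wg j isT; rewrite /W jJ (negPf (J12 j jJ)).
      by case: (g j =P _); rewrite ?eqxx.
    have gY : lies_in (mx g).
      apply/forallP=> j; rewrite row_mx.
      have [jJ1|jJ1] := boolP (j \in J1); first by rewrite gJ1 //; apply: (forallP CPhi).
      have [jJ2|jJ2] := boolP (j \in J2); first by rewrite gJ2 //; apply: (forallP C'Phi).
      by have := Wg j isT; rewrite /W (negPf jJ1) (negPf jJ2); apply: hY.
    have /submxP[D /(congr1 trmx)] : ((mx g)^T <= T^T)%MS.
      apply: contraNT CBad => nsub; rewrite CPhi /=; apply/existsP; exists (mx g).
      rewrite inE Ag eqxx gY nsub /=; apply/forallP=> j; apply/implyP=> jJ.
      by rewrite row_mx gJ1.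
    rewrite trmx_mul !trmxK => gD.
    have DC : D^T = C.
      by apply: (row_span_full_inj r1) => j jJ; rewrite -gD row_mx gJ1.
    have DC' : D^T = C'.
      by apply: (row_span_full_inj r2) => j jJ; rewrite -gD row_mx gJ2.
    split; first by rewrite -DC.
    by apply/ffunP=> j; rewrite ffunE -DC -gD row_mx.
  have [CC'|CC'] /= := eqVneq C C'; last first.
    rewrite /M big1 ?eqxx // => g _; apply/eqP; apply: contraNT CC' => /mxT[-> _].
    by rewrite eqxx.
  subst C'; pose g0 : {ffun 'I_k -> 'rV[F]_d} := [ffun j => row j (T *m C)].
  rewrite /M (bigD1 g0) //= [X in _ + X]big1 ?addr0 => [|g gg0]; last first.
    by apply/eqP; apply: contraNT gg0 => /mxT[_ ->].
  have -> : mx g0 = T *m C by apply/row_matrixP=> j; rewrite row_mx ffunE.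
  rewrite mulmxA AT0 mul0mx eqxx mul1r; apply/negbTE/prodf_neq0=> j _.
  rewrite ffunE /W; case: ifP => jJ1; first by rewrite eqxx oner_eq0.
  case: ifP => jJ2; first by rewrite eqxx oner_eq0.
  apply: contraNN CZero => hj; apply/bigcupP; exists j.
    by rewrite !inE jJ1 jJ2.
  by rewrite !inE -row_mul (forallP CPhi) hj.
have leBad : (#|Bad| <= #|extra_solutions|)%N.
  (* An extra solution determines [C] through its rows in [J1], because the rows of [T] there have
     full rank. *)
  pose f (X : 'M[F]_(k, d)) := odflt 0 [pick C : 'M[F]_(r, d)
    | [forall j in J1, row j X == row j (T *m C)]].
  apply: leq_trans (leq_imset_card f _).
  apply/subset_leq_card/subsetP=> C; rewrite inE => /andP[_].
  case/existsP=> X /andP[Xex /forallP XC]; apply/imsetP; exists X => //.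
  rewrite /f; case: pickP => [C' /forallP XC'|/(_ C)/negP[]]; last exact/forallP.
  apply: (row_span_full_inj r1) => j jJ.
  have := XC j; have := XC' j; rewrite jJ => /eqP<- /eqP<- //.
(* As row [j] of [T] is nonzero, each of the at most [#|B|] zeros of [h j] is attained for at most
   [q ^ (d * (r - 1))] matrices [C]. *)
have leZero j : (#|Zero j| <= #|B| * #|F| ^ (d * (r - 1)))%N.
  apply: leq_trans (_ : #|\bigcup_(y in [set y in Y j | h j y == 0%R])
      [set C : 'M[F]_(r, d) | row j T *m C == y]| <= _)%N.
    apply/subset_leq_card/subsetP=> C; rewrite inE => CZ.
    by apply/bigcupP; exists (row j T *m C); rewrite // inE.
  rewrite (leq_trans (card_bigcup_le _ _)) //.
  apply: (@leq_trans (\sum_(y in [set y in Y j | h j y == 0%R]) #|F| ^ (d * (r - 1))));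
    last by rewrite sum_nat_const leq_mul2r hZ orbT.
  apply: leq_sum => y _; rewrite (leq_trans (card_mulmx_fiber _ _)) //.
  by rewrite rank_rV Tj.
have cRest : (#|J1| + #|J2| + #|Rest| = k)%N.
  rewrite -[RHS](card_ord k) -(cardsC (J1 :|: J2)) cardsU (_ : J1 :&: J2 = set0).
    by rewrite cards0 subn0.
  by apply/setP=> j; rewrite !inE; case: (boolP (j \in J2)) => [/J12/negPf->|]; rewrite ?andbF.
have leU : (#|\bigcup_(j in Rest) Zero j| <= #|Rest| * (#|B| * #|F| ^ (d * (r - 1))))%N.
  by rewrite (leq_trans (card_bigcup_le _ _)) // -sum_nat_const leq_sum.
have := card_low_keys J1; have := card_low_keys J2; rewrite -/K1 -/K2 cJ1 cJ2.
have leP : (#|Phi| <= #|S| + (#|Bad| + #|\bigcup_(j in Rest) Zero j|))%N.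
  rewrite -(cardsID (Bad :|: \bigcup_(j in Rest) Zero j) Phi) addnC leq_add2l.
  by rewrite (leq_trans _ (leq_card_setU _ _)) // subset_leq_card // subsetIr.
rewrite cJ1 cJ2 in cRest; rewrite -/Phi; move: (#|B| * _)%N leU => N leU.
have : (k * N = r * N + r * N + #|Rest| * N)%N by rewrite -!mulnDl cRest.
move: leS leBad leP leU; clear; lia.
Qed.

End SliceBound.

(** * Few monomials have low degree *)

Lemma poly_pos_left_of_root (R : realFieldType) (f : {poly R}) :
  f.[1] = 0 -> f^`().[1] < 0 -> exists2 x : R, 0 < x < 1 & 0 < f.[x].
Proof.
move=> /eqP/factor_theorem[g ->].
rewrite derivM derivB derivX derivC subr0 !hornerE subrr mulr0 add0r => g1.
have /factor_theorem[c defc] : root (g - g.[1]%:P) 1 by rewrite /root !hornerE subrr.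
pose b := \sum_(i < size c) `|c`_i|.
have b0 : 0 <= b by apply: sumr_ge0.
(* The first bound keeps [1 - t] in the unit interval, the second keeps the change of [g], at most
   [t * b], below [- g.[1]]; [b + 1] avoids a division by 0. *)
pose t : R := Num.min (2^-1) (- g.[1] / (2 * (b + 1))).
have t0 : 0 < t by rewrite lt_min invr_gt0 ltr0n divr_gt0 ?oppr_gt0 // mulr_gt0 // ltr_wpDl.
have t1 : t <= 2^-1 by rewrite ge_min lexx.
have tb : t * (2 * (b + 1)) <= - g.[1].
  by rewrite -ler_pdivlMr ?mulr_gt0 ?ltr_wpDl // ge_min lexx orbT.
have x01 : 0 < 1 - t < 1 by apply/andP; split; lra.
exists (1 - t) => //.
have cb : `|c.[1 - t]| <= b.
  rewrite horner_coef (le_trans (ler_norm_sum _ _ _)) //; apply: ler_sum => i _.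
  rewrite normrM ler_piMr // normrX exprn_ile1 // ger0_norm; lra.
have gE : g.[1 - t] = g.[1] - t * c.[1 - t].
  have := congr1 (fun p => p.[1 - t]) defc; rewrite !hornerE /= => gE; lra.
rewrite !hornerE gE.
have : - (t * c.[1 - t]) <= t * b.
  rewrite -mulrN ler_wpM2l ?(ltW t0) // (le_trans _ cb) // -normrN ler_norm //.
move=> h; have : t * b <= t * (b + 1) by rewrite ler_wpM2l ?(ltW t0) //; lra.
move: tb h; rewrite mulrCA; nra.
Qed.

Lemma double_sum_ord n : (2 * \sum_(i < n.+1) i = n * n.+1)%N.
Proof.
elim: n => [|n IHn]; first by rewrite big_ord1.
by rewrite big_ord_recr /= mulnDr IHn; lia.
Qed.

Lemma exists_exp_ge (R : archiRealFieldType) (t c : R) :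
  1 < t -> exists2 L, (0 < L)%N & c <= t ^+ L.
Proof.
move=> t1; have bernoulli n : 1 + (t - 1) *+ n <= t ^+ n.
  elim: n => [|n IHn]; first by rewrite mulr0n addr0 expr0.
  rewrite exprS (le_trans _ (ler_wpM2l (ltW (lt_trans ltr01 t1)) IHn)) //.
  have : 0 <= (t - 1) * ((t - 1) *+ n) by rewrite mulr_ge0 ?mulrn_wge0 ?subr_ge0 ?ltW.
  by rewrite mulrS; nra.
have t10 : 0 < t - 1 by rewrite subr_gt0.
exists (Num.bound `|c / (t - 1)|).+1 => //.
apply: le_trans (bernoulli _).
have /ltW := archi_boundP (normr_ge0 (c / (t - 1))).
move/(le_trans (ler_norm _)); rewrite ler_pdivrMr // => cb.
rewrite mulrS -mulr_natl; lra.
Qed.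

Section LowExponents.
Variables (F : finFieldType) (m k : nat).
Local Notation p := #|F|.-1.

(** Give [e] the weight [x ^ (k * \sum_l e l)]. The total weight factors over the coordinates, and
    since [x < 1], each low exponent weighs at least [x ^ (d * (m * p))]. *)
Lemma card_low_exponents_chernoff (R : realFieldType) (x : R) d : 0 < x < 1 ->
  #|low_exponents F m k d|%:R * x ^+ (d * (m * p))
    <= (\sum_(i < p.+1) x ^+ (k * i)) ^+ d.
Proof.
move=> /andP[x0 x1]; set g := \sum_(i < _) _.
have -> : g ^+ d = \prod_(l < d) g by rewrite prodr_const card_ord.
rewrite bigA_distr_bigA /=.
rewrite mulr_natl -sumr_const [X in _ <= X](bigID (mem (low_exponents F m k d))) /=.
rewrite -[X in X <= _]addr0 lerD ?sumr_ge0 //; last first.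
  by move=> e _; apply: prodr_ge0 => l _; rewrite exprn_ge0 // ltW.
apply: ler_sum => e; rewrite inE => e_low.
by rewrite -expr_sum -big_distrr ler_wiXn2l // ltW.
Qed.

(** The Chernoff bound is trivial at [x = 1]. There [f] has derivative [q p (m - k / 2) < 0], so
    some [x < 1] gains a factor [t > 1] per coordinate; [L] coordinates with [q <= t ^ L] gain a
    factor [q]. *)
Lemma card_low_exponents_le : (2 * m < k)%N ->
  exists2 L, (0 < L)%N &
    forall D, (#|low_exponents F m k (L * D)| * #|F| ^ D <= #|F| ^ (L * D))%N.
Proof.
move=> mk; have q0 : (0 < #|F|)%N by rewrite -card_finField_pred.
pose f : {poly rat} := #|F|%:R *: 'X^(m * p) - \sum_(i < p.+1) 'X^(k * i).
have f1 : f.[1] = 0.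
  rewrite /f !hornerE horner_sum expr1n mulr1.
  under eq_bigr do rewrite hornerXn expr1n.
  by rewrite sumr_const card_ord card_finField_pred subrr.
have f'1 : f^`().[1] < 0.
  have -> : f^`().[1] = (#|F| * (m * p))%:R - (k * \sum_(i < p.+1) i)%:R.
    rewrite /f derivB derivZ derivXn raddf_sum hornerD hornerN hornerZ hornerMn.
    rewrite hornerXn expr1n horner_sum; congr (_ - _); first by rewrite -natrM.
    rewrite natrM natr_sum mulr_sumr; apply: eq_bigr => i _.
    by rewrite /= derivXn hornerMn hornerXn expr1n natrM.
  have := double_sum_ord p; rewrite subr_lt0 ltr_nat; set s := (\sum_(i < _) _)%N => sE.
  rewrite -(ltn_pmul2l (isT : 0 < 2)%N) (mulnCA 2 k) sE card_finField_pred.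
  rewrite (_ : 2 * (#|F| * (m * p)) = 2 * m * (p * #|F|))%N; last by ring.
  by rewrite ltn_pmul2r // muln_gt0 card_finField_pred_gt0.
have [x x01 fx] := poly_pos_left_of_root f1 f'1.
pose g := \sum_(i < p.+1) x ^+ (k * i).
pose w := x ^+ (m * p).
have [x0 x1] := andP x01.
have w0 : 0 < w by rewrite exprn_gt0.
have g0 : 0 < g.
  rewrite /g big_ord_recl muln0 expr0 ltr_wpDr // sumr_ge0 // => i _.
  by rewrite exprn_ge0 // ltW.
have gw : g < #|F|%:R * w.
  move: fx; rewrite /f !hornerE horner_sum subr_gt0.
  by under eq_bigr do rewrite hornerXn.
have t1 : 1 < #|F|%:R * w / g by rewrite ltr_pdivlMr ?mul1r.
have [L L0 qL] := exists_exp_ge #|F|%:R t1.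
exists L => // D; rewrite -(ler_nat rat) natrM !natrX.
rewrite -(ler_pM2r (exprn_gt0 (L * D) w0)) mulrAC.
have wE : w ^+ (L * D) = x ^+ (L * D * (m * p)) by rewrite -exprM mulnC.
have ch := card_low_exponents_chernoff (L * D) x01; rewrite -/g -wE in ch.
apply: le_trans (ler_wpM2r _ ch) _; first by rewrite exprn_ge0.
have qw0 : 0 <= #|F|%:R * w by rewrite mulr_ge0 // ltW.
rewrite !exprM -!exprMn lerXn2r ?nnegrE ?mulr_ge0 ?exprn_ge0 ?(ltW g0) //.
by move: qL; rewrite expr_div_n ler_pdivlMr ?exprn_gt0 // mulrC exprMn.
Qed.

End LowExponents.

(** * Restricting to random graphs *)

Lemma card_pairs (I J : finType) (P : I -> J -> bool) :
  #|[set p : I * J | P p.1 p.2]| = (\sum_i #|[set j | P i j]|)%N.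
Proof.
rewrite -sum1dep_card -(pair_big_dep xpredT P (fun _ _ => 1%N)) /=.
by apply: eq_bigr => i _; rewrite sum1dep_card.
Qed.

Section Sampling.
Variables (F : finFieldType) (m k r h d : nat).
Variables (A : 'M[F]_(m, k)) (T : 'M[F]_(k, r)) (S : {set 'rV[F]_(h + d)}).

(* [Z] encodes the random affine maps [y |-> row_mx y (row j T) *m Z]; the
   vectors of [S] on the graph of the [j]-th map are identified with their last
   [d] coordinates. *)
Definition graph_slice (Z : 'M[F]_(d + r, h)) (j : 'I_k) : {set 'rV[F]_d} :=
  [set y | row_mx (row_mx y (row j T) *m Z) y \in S].

Lemma lies_in_graph_slice Z (X : 'M[F]_(k, d)) :
  lies_in (graph_slice Z) X = lies_in (fun=> S) (row_mx (row_mx X T *m Z) X).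
Proof.
apply: eq_forallb => j; rewrite inE; congr (_ \in S).
by rewrite row_row_mx row_mul row_row_mx.
Qed.

Hypotheses (k_gt0 : (0 < k)%N) (AT0 : A *m T = 0).
Hypothesis T_row_neq0 : forall j, row j T != 0.

(** For each [C] and each upper block of [Z], one lower block makes the graphs contain the rows of
    [T *m C]: a fraction [q ^ (- h r)] of all [Z]. *)
Lemma sum_slice_param_ge :
  (#|F| ^ (d * h) * #|[set C : 'M[F]_(r, h + d) | lies_in (fun=> S) (T *m C)]|
   <= \sum_Z #|[set D : 'M[F]_(r, d) | lies_in (graph_slice Z) (T *m D)]|)%N.
Proof.
rewrite -card_pairs -card_mx -cardsT -cardsX.
pose f (p : 'M[F]_(d, h) * 'M[F]_(r, h + d)) :=
  (col_mx p.1 (lsubmx p.2 - rsubmx p.2 *m p.1), rsubmx p.2).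
have f_inj : injective f.
  move=> [M C] [M' C'] /= [/eq_col_mx[-> eqC] eqD].
  rewrite eqD in eqC; move/addIr: eqC => eqC.
  by rewrite -[C]hsubmxK -[C']hsubmxK eqC eqD.
rewrite -(card_imset _ f_inj); apply/subset_leq_card/subsetP=> _ /imsetP[[M C] MC ->].
move: MC; rewrite !inE /= lies_in_graph_slice.
have -> : row_mx (T *m rsubmx C) T = T *m row_mx (rsubmx C) 1%:M.
  by rewrite mul_mx_row mulmx1.
rewrite -mulmxA mul_row_col mul1mx addrC subrK -mul_mx_row hsubmxK //.
Qed.

(** Because [A *m T = 0], a solution in a slice lifts to a solution [X] in [S]. The [Z] that capture
    [X] satisfy a linear system with matrix [B = row_mx (rsubmx X) T], whose rank is at least that
    of [X], since [X] factors through [B], and exceeds [r], since [rsubmx X] is not of the form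
    [T *m D]. *)
Lemma sum_slice_extra_le : \rank T = r ->
  (\sum_Z #|extra_solutions A T (graph_slice Z)|
   <= \sum_(X : 'M[F]_(k, h + d) | (A *m X == 0)%R && lies_in (fun=> S) X)
        #|F| ^ (h * (d + r - maxn (\rank X) r.+1)))%N.
Proof.
move=> rT.
pose P (X : 'M[F]_(k, h + d)) (Z : 'M[F]_(d + r, h)) :=
  [&& A *m X == 0, lies_in (fun=> S) X, ~~ ((rsubmx X)^T <= T^T)%MS &
      row_mx (rsubmx X) T *m Z == lsubmx X].
apply: (@leq_trans (\sum_X #|[set Z | P X Z]|)).
  rewrite -!card_pairs.
  pose f (p : 'M[F]_(d + r, h) * 'M[F]_(k, d)) :=
    (row_mx (row_mx p.2 T *m p.1) p.2, p.1).
  have f_inj : injective f.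
    by move=> [Z X] [Z' X'] /= [/eq_row_mx[_ ->] ->].
  rewrite -(card_imset _ f_inj); apply/subset_leq_card/subsetP=> _ /imsetP[[Z X] ZX ->].
  move: ZX; rewrite !inE /= lies_in_graph_slice => /and3P[/eqP AX XS XT].
  rewrite /P row_mxKr row_mxKl XS XT eqxx !andbT.
  by rewrite mul_mx_row mulmxA mul_mx_row AX AT0 row_mx0 mul0mx row_mx0.
rewrite [X in (_ <= X)%N]big_mkcond; apply: leq_sum => X _.
have [->|[Z0]] := set_0Vmem [set Z | P X Z]; first by rewrite cards0.
rewrite inE => /and4P[AX XS XT /eqP XZ0]; rewrite AX XS /=.
set B := row_mx (rsubmx X) T in XZ0.
apply: leq_trans (_ : #|F| ^ (h * (d + r - \rank B)) <= _)%N.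
  apply: leq_trans (card_mulmx_fiber B (lsubmx X)).
  by apply/subset_leq_card/subsetP=> Z; rewrite !inE => /and4P[].
rewrite leq_exp2l ?finNzRing_gt1 // leq_mul2l; apply/orP; right.
apply: leq_sub2l; rewrite geq_max; apply/andP; split.
  have -> : X = B *m row_mx Z0 (col_mx 1%:M 0).
    by rewrite mul_mx_row mul_row_col mulmx1 mulmx0 addr0 XZ0 hsubmxK.
  exact: mxrankM_maxl.
rewrite -[X in (X < _)%N]rT -mxrank_tr -[\rank B]mxrank_tr; apply: rank_ltmx.
rewrite tr_row_mx ltmxE; apply/andP; split.
  by rewrite -addsmxE addsmxSr.
by apply: contra XT => /(submx_trans _); apply; rewrite -addsmxE addsmxSl.
Qed.

(** [card_param_le] is summed over all [Z]. *)
Lemma card_param_sampling (J : {set 'I_k}) :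
  \rank (row_span T J) = r -> \rank (row_span T (~: J)) = r ->
  (#|F| ^ (d * h) * #|[set C : 'M[F]_(r, h + d) | lies_in (fun=> S) (T *m C)]|
   <= #|F| ^ ((d + r) * h) * (k * (#|low_exponents F m k d| * #|F| ^ (d * (r - 1))))
    + \sum_(X : 'M[F]_(k, h + d) | (A *m X == 0)%R && lies_in (fun=> S) X)
        #|F| ^ (h * (d + r - maxn (\rank X) r.+1)))%N.
Proof.
move=> fullJ fullJc.
have rT : \rank T = r.
  apply/eqP; rewrite eqn_leq rank_leq_col -[X in (X <= _)%N]fullJ.
  have -> : \rank T = \rank (row_span T setT) by rewrite row_span_setT.
  by rewrite mxrankS // row_spanS ?subsetT.
apply: leq_trans sum_slice_param_ge _.
set c := (k * _)%N.
have <- : (\sum_(Z : 'M[F]_(d + r, h)) c = #|F| ^ ((d + r) * h) * c)%N.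
  by rewrite sum_nat_const card_mx.
apply: leq_trans (leq_add (leqnn _) (sum_slice_extra_le rT)).
rewrite -big_split /=; apply: leq_sum => Z _.
exact: (card_param_le _ k_gt0 AT0 T_row_neq0 fullJ fullJc).
Qed.

End Sampling.

(** * Increasing the rank *)

Section Solutions.
Variables (F : finFieldType) (m k n : nat) (A : 'M[F]_(m, k)) (S : {set 'rV[F]_n}).

Definition solutions_of_rank (r : nat) : {set 'M[F]_(k, n)} :=
  [set X | [&& A *m X == 0, lies_in (fun=> S) X & \rank X == r]].

Lemma solutions_of_rank_factor r X : X \in solutions_of_rank r ->
  exists (T : 'M[F]_(k, r)) (C : 'M[F]_(r, n)),
    [/\ X = T *m C, \rank T = r, A *m T = 0 & lies_in (fun=> S) (T *m C)].
Proof.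
rewrite inE => /and3P[/eqP AX XS /eqP rX]; subst r.
exists (col_base X), (row_base X); rewrite mulmx_base; split=> //.
  exact/eqP/col_base_full.
by apply: (row_free_inj (row_base_free X)); rewrite -mulmxA mulmx_base AX mul0mx.
Qed.

Lemma card_solutions_of_rank_le r :
  (#|solutions_of_rank r| <= #|F| ^ (k * r + r * n))%N.
Proof.
rewrite expnD -!card_mx -card_prod -cardsT.
apply: leq_trans (leq_imset_card
  (fun p : 'M[F]_(k, r) * 'M[F]_(r, n) => p.1 *m p.2) _).
apply/subset_leq_card/subsetP=> X /solutions_of_rank_factor[T [C [-> _ _ _]]].
by apply/imsetP; exists (T, C); rewrite ?inE.
Qed.

(** Among the at most [q ^ (k r)] left factors [T], take one with the most parameters. The witness
    [C] serves to show that [T] has no zero row when [0] is not in [S]. *)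
Lemma solutions_of_rank_pigeonhole r : (0 < #|solutions_of_rank r|)%N ->
  exists T : 'M[F]_(k, r), [/\ \rank T = r, A *m T = 0,
    exists C : 'M[F]_(r, n), lies_in (fun=> S) (T *m C) &
    (#|solutions_of_rank r|
       <= #|F| ^ (k * r) * #|[set C : 'M[F]_(r, n) | lies_in (fun=> S) (T *m C)]|)%N].
Proof.
pose good (T : 'M[F]_(k, r)) := [&& \rank T == r, A *m T == 0 &
  [exists C : 'M[F]_(r, n), lies_in (fun=> S) (T *m C)]].
have goodE X : X \in solutions_of_rank r ->
    exists T C, [/\ X = T *m C, good T & lies_in (fun=> S) (T *m C)].
  move=> /solutions_of_rank_factor[T [C [-> rT AT TC]]]; exists T, C; split=> //.
  by rewrite /good rT AT !eqxx; apply/existsP; exists C.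
case/card_gt0P=> X /goodE[T0 [C0 [_ T0good _]]].
pose param (T : 'M[F]_(k, r)) := [set C : 'M[F]_(r, n) | lies_in (fun=> S) (T *m C)].
case: (arg_maxnP (fun T => #|param T|) T0good) => T Tgood Tmax.
have /and3P[/eqP rT /eqP AT /existsP TC] := Tgood.
exists T; split=> //; rewrite -card_mx -sum_nat_const.
apply: leq_trans (_ : \sum_(T' | good T') #|param T'| <= _)%N; last first.
  by rewrite big_mkcond; apply: leq_sum => T' _; case: ifP => // /Tmax.
apply: leq_trans (_ : #|\bigcup_(T' | good T') [set T' *m C | C in param T']| <= _)%N.
  apply/subset_leq_card/subsetP=> X' /goodE[T' [C [-> T'good T'C]]].
  by apply/bigcupP; exists T' => //; apply/imsetP; exists C; rewrite ?inE.
apply: leq_trans (card_bigcup_le _ _) _; apply: leq_sum => T' _.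
exact: leq_imset_card.
Qed.

Lemma sum_solutions_by_rank (f : nat -> nat) :
  (\sum_(X : 'M[F]_(k, n) | (A *m X == 0)%R && lies_in (fun=> S) X) f (\rank X)
     = \sum_(s < k.+1) #|solutions_of_rank s| * f s)%N.
Proof.
rewrite (partition_big (fun X : 'M[F]_(k, n) => inord (\rank X) : 'I_k.+1) xpredT) //=.
apply: eq_bigr => s _; rewrite -sum_nat_const; apply: eq_big => [X|X].
  have rE : (inord (\rank X) == s) = (\rank X == s).
    by rewrite -val_eqE /= inordK // ltnS rank_leq_row.
  by rewrite inE rE andbA.
by case/andP=> _ /eqP rX; rewrite -rX inordK // ltnS rank_leq_row.
Qed.

(** The constant solutions, which exist by row balance, start the induction on the rank. *)
Lemma card_solutions_of_rank1 : (0 < k)%N -> row_balanced A -> 0 \notin S ->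
  (#|S| <= #|solutions_of_rank 1|)%N.
Proof.
move=> k_gt0 A0 S0; pose one := \col_(j < k) (1 : F).
have row1 j (x : 'rV[F]_n) : row j (one *m x) = x.
  by apply/rowP=> l; rewrite !mxE big_ord1 !mxE mul1r.
have f_inj : injective (mulmx one : 'rV[F]_n -> _).
  by move=> x y eqxy; rewrite -(row1 (Ordinal k_gt0) x) eqxy row1.
rewrite -(card_imset _ f_inj); apply/subset_leq_card/subsetP=> _ /imsetP[x xS ->].
rewrite inE; apply/and3P; split.
- rewrite mulmxA (_ : A *m one = 0) ?mul0mx //; apply/colP=> i.
  by rewrite !mxE -[RHS](A0 i); apply: eq_bigr => j _; rewrite mxE mulr1.
- by apply/forallP=> j; rewrite row1.
rewrite eqn_leq (leq_trans (mxrankM_maxl _ _) (rank_leq_col _)) lt0n mxrank_eq0.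
apply: contraNneq S0 => x0.
by rewrite -(row1 (Ordinal k_gt0) x) x0 row0 in xS.
Qed.

End Solutions.

(* Each term of the sampling inequality is compared with [q ^ (d * h + r * n)],
   where [n = h + d]. *)
Lemma sampling_contradiction (q k r h d D a c' Phi B : nat) (N : nat -> nat) :
  (1 < q -> 0 < r -> r <= k -> k <= d -> 0 < d ->
   k * r + a + k + 3 <= h -> a + k + 2 <= D -> k * d + a + k + 3 <= c' ->
   B * q ^ D <= q ^ d ->
   (forall s, N s <= q ^ (k * s + s * (h + d))) ->
   (forall s, r < s -> N s * q ^ c' <= q ^ (s * (h + d))) ->
   q ^ (r * (h + d)) <= Phi * q ^ a ->
   q ^ (d * h) * Phi <= q ^ ((d + r) * h) * (k * (B * q ^ (d * (r - 1))))
     + \sum_(s < k.+1) N s * q ^ (h * (d + r - maxn s r.+1)) -> False)%N.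
Proof.
move=> q1 r0 rk kd d0 h_ge D_ge c'_ge BD Nle Nbig Phi_ge sampling.
have q0 : (0 < q)%N by rewrite ltnW.
have expq x y : (x <= y)%N -> (q ^ x <= q ^ y)%N by move=> xy; rewrite leq_exp2l.
pose E := (d * h + r * (h + d))%N.
set T1 := (q ^ ((d + r) * h) * _)%N in sampling.
set T2 := (\sum_(s < k.+1) _)%N in sampling.
have k_lt : (k < q ^ k)%N by apply: ltn_expl.
(* [T1] and [T2] are each at most [q ^ E / (4 q ^ a)], because [4 <= q ^ 2], while their sum must be
   at least [q ^ E / q ^ a]. *)
have T1_le : (T1 * q ^ a * q ^ 2 <= q ^ E)%N.
  have le1 : (T1 * q ^ D <= k * q ^ E)%N.
    rewrite (_ : T1 * q ^ D = k * (q ^ ((d + r) * h + d * (r - 1)) * (B * q ^ D)))%N; last first.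
      by rewrite /T1 expnD; ring.
    rewrite leq_mul2l; apply/orP; right.
    apply: leq_trans (leq_mul (leqnn _) BD) _; rewrite -expnD; apply: expq.
    have : (d * 1 <= d * r)%N by rewrite leq_mul2l r0 orbT.
    by rewrite /E mulnBr; lia.
  have le2 : (T1 * q ^ (a + k + 2) <= k * q ^ E)%N.
    by apply: leq_trans le1; rewrite leq_mul2l expq ?orbT.
  have le3 : (T1 * q ^ a * q ^ 2 * q ^ k <= q ^ E * q ^ k)%N.
    rewrite (_ : _ * q ^ k = T1 * q ^ (a + k + 2))%N; last by rewrite !expnD; ring.
    by apply: leq_trans le2 _; rewrite mulnC leq_mul2l (ltnW k_lt) orbT.
  by rewrite leq_pmul2r ?expn_gt0 ?q0 // in le3.
have T2_le : (T2 * q ^ a * q ^ 2 <= q ^ E)%N.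
  have term (s : 'I_k.+1) :
      (N s * q ^ (h * (d + r - maxn s r.+1)) * q ^ (a + k + 3) <= q ^ E)%N.
    (* For [s <= r] the trivial bound on [N s] suffices, as [r + 1] in place of [r] saves [q ^ h].
       For [s > r] the scarcity factor [q ^ c'] outweighs the excess [q ^ ((s - r) * d)]. *)
    case: (leqP s r) => sr.
      rewrite (_ : maxn s r.+1 = r.+1); last by apply/maxn_idPr; apply: leqW.
      rewrite (_ : d + r - r.+1 = d - 1)%N; last lia.
      apply: leq_trans (leq_mul (leq_mul (Nle s) (leqnn _)) (leqnn _)) _.
      rewrite -!expnD; apply: expq; rewrite /E mulnBr.
      have : (k * s <= k * r)%N by rewrite leq_mul2l sr orbT.
      have : (s * (h + d) <= r * (h + d))%N by rewrite leq_mul2r sr orbT.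
      have : (h * 1 <= h * d)%N by rewrite leq_mul2l d0 orbT.
      lia.
    rewrite (_ : maxn s r.+1 = s); last exact/maxn_idPl.
    rewrite -(@leq_pmul2r (q ^ c')) ?expn_gt0 ?q0 //.
    set u := (q ^ (h * _))%N; set v := (q ^ (_ + 3))%N.
    rewrite (_ : N s * u * v * q ^ c' = N s * q ^ c' * (u * v))%N; last by ring.
    apply: leq_trans (leq_mul (Nbig s sr) (leqnn _)) _.
    rewrite /u /v -!expnD; apply: expq; rewrite /E.
    have sk := ltn_ord s; rewrite ltnS in sk.
    rewrite -(subnKC (ltnW sr)); set t := (s - r)%N.
    have tk : (t <= k)%N by rewrite (leq_trans (leq_subr _ _)).
    rewrite (_ : d + r - (r + t) = d - t)%N; last lia.
    have : (t * d <= k * d)%N by rewrite leq_mul2r tk orbT.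
    have : (h * (d - t) + h * t = h * d)%N by rewrite -mulnDr subnK // (leq_trans tk).
    clearbody t; move: (d - t)%N c'_ge => z; clear; lia.
  have sum_le : (T2 * q ^ (a + k + 3) <= k.+1 * q ^ E)%N.
    rewrite /T2 big_distrl -[X in (_ <= X * _)%N]card_ord -sum_nat_const.
    exact: leq_sum.
  have le3 : (T2 * q ^ a * q ^ 2 * q ^ k.+1 <= q ^ E * q ^ k.+1)%N.
    rewrite (_ : _ * q ^ k.+1 = T2 * q ^ (a + k + 3))%N; last first.
      by rewrite !expnD !expnS; ring.
    apply: leq_trans sum_le _; rewrite mulnC leq_mul2l.
    by rewrite (ltnW (ltn_expl _ q1)) orbT.
  by rewrite leq_pmul2r ?expn_gt0 ?q0 // in le3.
have E_le : (q ^ E <= (T1 + T2) * q ^ a)%N.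
  apply: leq_trans (leq_mul sampling (leqnn _)).
  by rewrite -mulnA /E expnD leq_mul2l Phi_ge orbT.
have E_gt0 : (0 < q ^ E)%N by rewrite expn_gt0 q0.
have q2 : (4 <= q ^ 2)%N by rewrite (@leq_exp2r 2 q 2).
move: E_gt0 E_le q2 T1_le T2_le; clear.
move: (q ^ E)%N (q ^ a)%N (q ^ 2)%N => e u v e0 le v4 le1 le2.
have : (e * v <= e + e)%N.
  by apply: leq_trans (leq_mul le (leqnn v)) _; rewrite mulnDl mulnDl leq_add.
have : (e * 4 <= e * v)%N by rewrite leq_mul2l v4 orbT.
lia.
Qed.

(** If all ranks above [r] were scarce, the two bases supplied by tameness would make the sampling
    inequality contradict the abundance in rank [r]. *)
Lemma solutions_of_higher_rank (F : finFieldType) (m r h d D b c' : nat)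
    (A : 'M[F]_(m, (2 * m + 1)%N)) (S : {set 'rV[F]_(h + d)}) :
  let k := (2 * m + 1)%N in let q := #|F| in
  tame A -> \rank A = m -> 0 \notin S -> (0 < r <= m)%N ->
  (k <= d -> 2 * k * r + b + k + 3 <= h -> k * r + b + k + 2 <= D ->
   k * d + k * r + b + k + 3 <= c' ->
   #|low_exponents F m k d| * q ^ D <= q ^ d ->
   q ^ (r * (h + d)) <= #|solutions_of_rank A S r| * q ^ b ->
   exists2 s, r < s & q ^ (s * (h + d)) <= #|solutions_of_rank A S s| * q ^ c')%N.
Proof.
move=> k q tameA rA S0 /andP[r0 rm] kd h_ge D_ge c'_ge BD Nr.
have q1 : (1 < q)%N by apply: finNzRing_gt1.
have [/existsP[s /andP[rs Ns]]|/existsPn none] := boolP [exists s : 'I_k.+1,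
  (r < s)%N && (q ^ (s * (h + d)) <= #|solutions_of_rank A S s| * q ^ c')%N].
  by exists s.
exfalso; have Nr0 : (0 < #|solutions_of_rank A S r|)%N.
  rewrite lt0n; apply: contraTneq Nr => ->; rewrite mul0n -ltnNge.
  by rewrite expn_gt0 (ltnW q1).
have [T [rT AT [C TC] N_le]] := solutions_of_rank_pigeonhole Nr0.
have T_row j : row j T != 0.
  apply: contraNneq S0 => Tj; have /forallP/(_ j) := TC.
  by rewrite row_mul Tj mul0mx.
have k_gt0 : (0 < k)%N by rewrite /k addn1.
have [J [fullJ fullJc]] : exists J : {set 'I_k},
    \rank (row_span T J) = r /\ \rank (row_span T (~: J)) = r.
  apply: disjoint_spanning_sets => [X Y|X|X]; first exact: row_span_submodular.
    exact: rank_leq_col.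
  exact: (tame_kernel_large X tameA AT rT rm).
have := card_param_sampling S k_gt0 AT T_row fullJ fullJc.
rewrite (sum_solutions_by_rank A S (fun s => (_ ^ (h * (d + r - maxn s r.+1)))%N)).
have rk : (r <= k)%N by rewrite /k; lia.
move=> sampling.
(* In [a], the term [k * r] is the pigeonhole loss and [b] the loss in the assumed count. *)
apply: (sampling_contradiction (a := (k * r + b)%N) (c' := c')
  (N := fun s => #|solutions_of_rank A S s|) q1 r0 rk kd _ _ _ _ BD _ _ _ sampling).
- lia.
- lia.
- lia.
- lia.
- exact: card_solutions_of_rank_le.
- move=> s rs /=; have [sk|ks] := leqP s k.
    have := none (Ordinal (sk : s < k.+1)%N); rewrite /= rs /= -ltnNge.
    exact: ltnW.
  rewrite (_ : #|_| = 0%N) //; apply/eqP; rewrite cards_eq0; apply/eqP/setP=> X.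
  rewrite !inE; apply/negP=> /and3P[_ _ /eqP rX].
  by have := rank_leq_row X; rewrite rX leqNgt ks.
apply: leq_trans Nr _; rewrite expnD mulnCA mulnA leq_mul2r.
by rewrite N_le orbT.
Qed.

(** Induction on [r]. Either the rank obtained already exceeds [r + 1], or it equals [r + 1] and is
    raised once more. All losses are kept linear in [b], uniformly in [n] and [S]. *)
Lemma solutions_of_rank_ge (F : finFieldType) (m : nat)
    (A : 'M[F]_(m, (2 * m + 1)%N)) :
  tame A -> \rank A = m -> row_balanced A ->
  forall r, (r <= m)%N ->
  exists c e, forall (n b : nat) (S : {set 'rV[F]_n}),
    (0 < b)%N -> (e * b <= n)%N -> 0 \notin S ->
    (#|F| ^ n <= #|S| * #|F| ^ b)%N ->
    exists2 s, (r < s)%N &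
      (#|F| ^ (s * n) <= #|solutions_of_rank A S s| * #|F| ^ (c * b))%N.
Proof.
move=> tameA rA A0; set k := (2 * m + 1)%N in A tameA rA A0 *.
have [L L0 BL] : exists2 L, (0 < L)%N & forall D,
    (#|low_exponents F m k (L * D)| * #|F| ^ D <= #|F| ^ (L * D))%N.
  by apply: card_low_exponents_le; rewrite /k addn1.
elim=> [|r IHr] rm.
  exists 1%N, 0%N => n b S b0 _ S0 Sn; exists 1%N => //; rewrite !mul1n.
  apply: leq_trans Sn _; rewrite leq_mul2r card_solutions_of_rank1 ?orbT //.
  by rewrite /k addn1.
have [c [e IH]] := IHr (ltnW rm).
(* Chosen so that [D = c1 * b] exceeds all the additive constants; this uses [0 < b] and
   [r + 1 <= k]. *)
pose c1 := (c + 2 * k * k + k + 3)%N.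
(* With [d = L * D], the first constant times [b] is [c * b + k * d + D]; the second leaves
   [h = n - d >= D] and lets the induction hypothesis apply. *)
exists (c + k * L * c1 + c1)%N, (e + L * c1 + c1)%N => n b S b0 n_ge S0 Sn.
have [s rs Ns] : exists2 s, (r < s)%N &
    (#|F| ^ (s * n) <= #|solutions_of_rank A S s| * #|F| ^ (c * b))%N.
  by apply: IH => //; move: n_ge; rewrite !mulnDl -addnA; apply: leq_trans; apply: leq_addr.
have q0 : (0 < #|F|)%N by rewrite ltnW // finNzRing_gt1.
move: rs; rewrite leq_eqVlt => /predU1P[rs|rs]; last first.
  exists s => //; apply: leq_trans Ns _; rewrite leq_mul2l; apply/orP; right.
  by rewrite leq_exp2l ?finNzRing_gt1 // leq_mul2r; apply/orP; right; lia.
subst s; pose D := (c1 * b)%N; pose d := (L * D)%N; pose h := (n - d)%N.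
have hd : n = (h + d)%N.
  rewrite subnK // (leq_trans _ n_ge) // !mulnDl /d /D mulnA.
  by rewrite -addnA (leq_trans (leq_addr _ _) (leq_addl _ _)).
clearbody h; subst n.
have kk_le : (k * r.+1 <= k * k)%N by rewrite leq_mul2l /k; lia.
have c1b : (c * b + 2 * k * k + k + 3 <= D)%N.
  have le_b x : (x <= x * b)%N by rewrite leq_pmulr.
  by rewrite /D /c1 !mulnDl !leq_add.
have Dd : (D <= d)%N by rewrite /d leq_pmull.
have hD : (D <= h)%N.
  move: n_ge; rewrite !mulnDl -!mulnA -/D -/d; lia.
have k_le_kk : (k <= k * k)%N by rewrite leq_pmulr // /k addn1.
apply: (@solutions_of_higher_rank _ _ _ _ _ D (c * b)) => //; rewrite -/k.
- lia.
- lia.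
- lia.
- have -> : ((c + k * L * c1 + c1) * b = c * b + k * d + D)%N by rewrite /d /D; ring.
  lia.
exact: BL.
Qed.

(** * From high rank to genericity and temperateness *)

(** The left kernel of [X] contains the row space of [A] and has dimension at most
    [(2 m + 1) - (m + 1) = m], so the two coincide; row balance makes the coefficients sum to 0. *)
Lemma generic_solution_of_rank (F : fieldType) (m n : nat)
    (A : 'M[F]_(m, (2 * m + 1)%N)) (X : 'M[F]_((2 * m + 1)%N, n)) :
  \rank A = m -> row_balanced A -> A *m X = 0 -> (m < \rank X)%N ->
  generic_solution A (fun j => row j X).
Proof.
move=> rA A0 AX rX.
have kerX : (kermx X :=: A)%MS.
  apply/eqmx_sym/eqmxP; rewrite -(mxrank_leqif_eq _).
    by rewrite mxrank_ker rA; have := mulmx0_rank_max AX; lia.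
  exact/sub_kermxP.
split=> [i|mu].
  have := mulmx_sum_row (row i A) X; rewrite -row_mul AX row0 => sum0.
  by rewrite [RHS]sum0; apply: eq_bigr => j _; rewrite mxE.
split=> [[muX _]|muA].
  by rewrite -kerX; apply/sub_kermxP; rewrite mulmx_sum_row.
split.
  by rewrite -mulmx_sum_row; apply/sub_kermxP; rewrite kerX.
have [B ->] := submxP muA.
under eq_bigr do rewrite mxE; rewrite exchange_big big1 // => i _ /=.
by rewrite -mulr_sumr A0 mulr0.
Qed.

Theorem theorem5p1 (R : realType) (F : finFieldType) (m : nat)
    (A : 'M[F]_(m, (2 * m + 1)%N)) :
  \rank A = m -> tame A -> row_balanced A -> temperate R A.
Proof.
move=> rA tameA A0.
have [c [e N_ge]] := solutions_of_rank_ge tameA rA A0 (leqnn m).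
have q1 : (1 < #|F|)%N by apply: finNzRing_gt1.
(* The summand 1 accounts for the vector [0], which is removed from [S]. *)
have card_le n b (S : {set 'rV[F]_n}) : (e.+1 * b <= n)%N ->
    ~ (exists x : 'I_(2 * m + 1) -> 'rV[F]_n,
         generic_solution A x /\ forall j, x j \in S) ->
    (#|S| <= #|F| ^ (n - b) + 1)%N.
  move=> bn nogen; have [->|b0] := posnP b.
    by rewrite subn0 (leq_trans (max_card _)) // card_mx mul1n leq_addr.
  rewrite (cardsD1 0 S) addnC leq_add ?leq_b1 // leqNgt; apply/negP=> S_gt.
  have S0 : 0 \notin S :\ 0 by rewrite !inE eqxx.
  have b_le : (b <= n)%N by apply: leq_trans bn; rewrite leq_pmull.
  have e_le : (e * b <= n)%N by apply: leq_trans bn; rewrite mulSn leq_addl.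
  have S_ge : (#|F| ^ n <= #|S :\ 0%R| * #|F| ^ b)%N.
    by rewrite -{1}(subnK b_le) expnD leq_mul2r (ltnW S_gt) orbT.
  have [s ms Ns] := N_ge n b (S :\ 0) b0 e_le S0 S_ge.
  have : (0 < #|solutions_of_rank A (S :\ 0%R) s|)%N.
    rewrite lt0n; apply: contraTneq Ns => ->.
    by rewrite mul0n -ltnNge expn_gt0 (ltnW q1).
  case/card_gt0P=> X; rewrite inE => /and3P[/eqP AX /forallP XS /eqP rX].
  apply: nogen; exists (fun j => row j X); split.
    by apply: generic_solution_of_rank; rewrite ?rX.
  by move=> j; have := XS j; rewrite inE => /andP[].
(* The saving is [b = n %/ e.+1]. In the constant [2 * q], the factor 2 absorbs the summand 1 and
   [q] the rounding of [b]. *)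
exists (e.+1%:R^-1); first by rewrite invr_gt0 ltr0n.
exists (2 * #|F|%:R) => n S nogen.
have := card_le n (n %/ e.+1)%N S _ nogen; rewrite mulnC leq_trunc_div => /(_ isT) S_le.
pose b := (n %/ e.+1)%N; rewrite -/b in S_le.
have q1R : 1 <= #|F|%:R :> R by rewrite ler1n ltnW.
have b_le : (b <= n)%N by apply: leq_div.
apply: (@le_trans _ _ (2 * #|F|%:R ^+ (n - b))).
  rewrite -natrX -natrM ler_nat (leq_trans S_le) // mul2n -addnn leq_add2l.
  by rewrite expn_gt0 (ltnW q1).
rewrite -mulrA ler_pM2l ?ltr0n // -powR_mulrn ?ler0n //.
rewrite -[X in X * _ `^ _]powRr1 ?ler0n // -powRD; last first.
  by rewrite pnatr_eq0 -lt0n (ltnW q1) implybT.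
rewrite ler_powR //.
have n_lt : (n < b.+1 * e.+1)%N by rewrite /b ltn_ceil.
rewrite natrB // mulrBl mul1r.
have : n%:R <= (b%:R + 1) * e.+1%:R :> R.
  by rewrite natr1 -natrM ler_nat ltnW.
rewrite -ler_pdivrMr ?ltr0n // => H.
have : e.+1%:R^-1 * n%:R <= b%:R + 1 :> R by rewrite mulrC.
move: (_^-1 * _) => u; lra.
Qed.
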